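(* Let $\alpha\ge 0$, let $\tau>0$, and let $\Phi_t(v)=e^{it\Delta}v+\widetilde\Phi_t(v)$, $t=\pm\tau$, be the numerical flow of a one-step scheme on $H^\alpha(\mathbb{T}^d)$, with $\widetilde\Phi_{\pm\tau}:H^\alpha(\mathbb{T}^d)\to H^\alpha(\mathbb{T}^d)$. Then the two-step scheme $$u^{n+1}=\Phi^{\text{2-step}}_\tau(u^n,u^{n-1}):=e^{2i\tau\Delta}u^{n-1}+\widetilde\Phi_\tau(u^n)-e^{2i\tau\Delta}\widetilde\Phi_{-\tau}(u^n),\qquad n\ge 1,$$ is symmetric, i.e. $$u^{n-1}=\Phi^{\text{2-step}}_{-\tau}\bigl(u^n,\Phi^{\text{2-step}}_{\tau}(u^n,u^{n-1})\bigr)\quad\text{for all } u^{n-1},u^n\in H^\alpha(\mathbb{T}^d)\text{ and all }\tau .$$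
   Context: $\mathbb{T}^d$, $d\in\{1,2,3\}$, is the $2\pi$-periodic torus; $H^\alpha=H^\alpha(\mathbb{T}^d)$ is the periodic Sobolev space with norm $\|u\|_{H^\alpha}^2=\sum_{\mathbf{k}\in\mathbb{Z}^d}(1+|\mathbf{k}|^2)^\alpha|\hat u_{\mathbf{k}}|^2$, where $u(\mathbf{x})=\sum_{\mathbf{k}}\hat u_{\mathbf{k}}e^{i\mathbf{k}\cdot\mathbf{x}}$. The operator $e^{it\Delta}$ is the Fourier multiplier with symbol $e^{-it|\mathbf{k}|^2}$. A two-step scheme $u^{n+1}=\Phi^{\text{2-step}}_\tau(u^n,u^{n-1})$ is called symmetric if $u^{n-1}=\Phi^{\text{2-step}}_{-\tau}(u^n,\Phi^{\text{2-step}}_{\tau}(u^n,u^{n-1}))$ for all $u^{n-1},u^n,\tau$; here $\Phi^{\text{2-step}}_{-\tau}$ is obtained by replacing $\tau$ by $-\tau$ everywhere in the definition of the scheme, i.e. $\Phi^{\text{2-step}}_{-\tau}(v,w)=e^{-2i\tau\Delta}w+\widetilde\Phi_{-\tau}(v)-e^{-2i\tau\Delta}\widetilde\Phi_{\tau}(v)$. *)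

(* Defs.v *)
From HB Require Import structures.
From mathcomp Require Import all_boot all_order all_algebra generic_quotient ring_quotient.
From mathcomp Require Import complex ring lra.
From mathcomp Require Import all_classical all_reals all_analysis measurable_realfun.

Set Implicit Arguments.
Unset Strict Implicit.
Unset Printing Implicit Defensive.

Import Order.TTheory GRing.Theory Num.Theory.
Import numFieldNormedType.Exports.

Local Open Scope classical_set_scope.
Local Open Scope ring_scope.

Definition cis (R : realType) (t : R) : R[i] := Complex (cos t) (sin t).

Definition sqmod (R : realType) (z : R[i]) : R :=
  complex.Re z ^+ 2 + complex.Im z ^+ 2.

Definition cmeasurable d (T : measurableType d) (R : realType) (f : T -> R[i]) :=
  measurable_fun setT (fun x => complex.Re (f x) : R) /\
  measurable_fun setT (fun x => complex.Im (f x) : R).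

Definition cintegral d (T : measurableType d) (R : realType)
    (mu : {measure set T -> \bar R}) (f : T -> R[i]) : R[i] :=
  Complex (\int[mu]_x complex.Re (f x)) (\int[mu]_x complex.Im (f x)).

(* A function on the 2pi-periodic torus is a function on R^d considered up to
   almost everywhere equality on the fundamental cell [0, 2pi]^d: [haar R d] is
   the normalized Lebesgue measure of that cell (the d-fold product of the
   uniform probability on [0, 2pi]), which does not charge its complement. *)
Notation torus R d := (d.-tuple (measurableTypeR R)).

Lemma twopi_gt0 (R : realType) : (0 : R) < 2 * pi.
Proof. by rewrite mulr_gt0 // pi_gt0. Qed.

Definition circle_measure (R : realType) :
    probability (measurableTypeR R) R :=
  uniform_prob (twopi_gt0 R).

Definition torus_cons (R : realType) (d : nat)
    (p : measurableTypeR R * torus R d) : torus R d.+1 :=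
  [tuple of p.1 :: p.2].

Lemma measurable_torus_cons (R : realType) (d : nat) :
  measurable_fun setT (@torus_cons R d).
Proof. exact: (measurable_cons measurable_fst measurable_snd). Qed.

HB.instance Definition _ (R : realType) (d : nat) :=
  isMeasurableFun.Build _ _ _ _ (@torus_cons R d) (@measurable_torus_cons R d).

Fixpoint haar (R : realType) (d : nat) : probability (torus R d) R :=
  match d return probability (torus R d) R with
  | 0 => \d_ ([tuple] : torus R 0)
  | d'.+1 => distribution (circle_measure R \x haar R d')%E (@torus_cons R d')
  end.

Definition wave_phase (R : realType) (d : nat) (k : d.-tuple int)
    (x : torus R d) : R :=
  \sum_(i < d) (tnth k i)%:~R * tnth x i.

Definition sqfreq (R : realType) (d : nat) (k : d.-tuple int) : R :=
  \sum_(i < d) (tnth k i)%:~R ^+ 2.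

Definition fourier_coef (R : realType) (d : nat) (u : torus R d -> R[i])
    (k : d.-tuple int) : R[i] :=
  cintegral (haar R d) (fun x => u x * cis (- wave_phase k x)).

Definition square_integrable (R : realType) (d : nat) (u : torus R d -> R[i]) :=
  (\int[haar R d]_x (sqmod (u x))%:E < +oo)%E.

Definition sobolev_sqnorm (R : realType) (d : nat) (alpha : R)
    (u : torus R d -> R[i]) : \bar R :=
  (\esum_(k in [set: d.-tuple int])
    ((1 + sqfreq R k) `^ alpha * sqmod (fourier_coef u k))%:E)%E.

(* For alpha >= 0, H^alpha(T^d) is the space of the square integrable functions whose
   H^alpha norm is finite. *)
Definition in_sobolev (R : realType) (d : nat) (alpha : R)
    (u : torus R d -> R[i]) : Prop :=
  [/\ cmeasurable u, square_integrable u & (sobolev_sqnorm alpha u < +oo)%E].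

Section Closure.
Context (R : realType) (d : nat).
Implicit Types (u v : torus R d -> R[i]) (z w : R[i]).
Local Notation mu := (haar R d).

Lemma ReB z w : complex.Re (z - w) = complex.Re z - complex.Re w.
Proof. by case: z w => [a b] [c e]. Qed.

Lemma ImB z w : complex.Im (z - w) = complex.Im z - complex.Im w.
Proof. by case: z w => [a b] [c e]. Qed.

Lemma sqmod_ge0 z : 0 <= sqmod z.
Proof. by rewrite /sqmod addr_ge0 ?sqr_ge0. Qed.

Lemma sqmodB_le z w : sqmod (z - w) <= sqmod z + sqmod z + (sqmod w + sqmod w).
Proof.
rewrite /sqmod ReB ImB; case: z w => [a b] [c e] /=.
by have := sqr_ge0 (a + c); have := sqr_ge0 (b + e); rewrite !expr2; lra.
Qed.

Lemma measurable_sqmod u : cmeasurable u ->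
  measurable_fun setT (fun x => sqmod (u x)).
Proof.
by case=> mr mi; apply: measurable_funD; apply: measurable_funX.
Qed.

Lemma cmeasurable0 : cmeasurable (0 : torus R d -> R[i]).
Proof. by split; exact: measurable_cst. Qed.

Lemma cmeasurableB u v : cmeasurable u -> cmeasurable v -> cmeasurable (u - v).
Proof.
move=> [ur ui] [vr vi]; split.
- rewrite (_ : (fun x => _) = (fun x => complex.Re (u x) - complex.Re (v x))).
    exact: measurable_funB.
  by apply/funext => x; rewrite -ReB.
- rewrite (_ : (fun x => _) = (fun x => complex.Im (u x) - complex.Im (v x))).
    exact: measurable_funB.
  by apply/funext => x; rewrite -ImB.
Qed.

Lemma square_integrable0 : square_integrable (0 : torus R d -> R[i]).
Proof.
rewrite /square_integrable integral0_eq ?ltry // => x _.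
by rewrite /sqmod /= expr0n addr0.
Qed.

Lemma square_integrableB u v : cmeasurable u -> cmeasurable v ->
  square_integrable u -> square_integrable v -> square_integrable (u - v).
Proof.
move=> mu_ mv su sv.
have p (z : R[i]) : (0 <= (sqmod z)%:E)%E by rewrite lee_fin sqmod_ge0.
have mE (f : torus R d -> R[i]) : cmeasurable f ->
    measurable_fun setT (fun x : torus R d => (sqmod (f x))%:E).
  by move=> mf; apply/measurable_EFinP; exact: (measurable_sqmod mf).
have mEU := mE _ mu_; have mEV := mE _ mv.
apply: (@le_lt_trans _ _ (\int[mu]_x
    (((sqmod (u x))%:E + (sqmod (u x))%:E)
     + ((sqmod (v x))%:E + (sqmod (v x))%:E)))%E).
  apply: ge0_le_integral => //.
  - by apply: mE; exact: cmeasurableB.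
  - by apply: emeasurable_funD; exact: emeasurable_funD.
  - by move=> x _; rewrite -!EFinD lee_fin; exact: sqmodB_le.
rewrite ge0_integralD //; last 4 first.
- by move=> x _; rewrite adde_ge0.
- exact: emeasurable_funD.
- by move=> x _; rewrite adde_ge0.
- exact: emeasurable_funD.
rewrite !ge0_integralD //.
by apply: lte_add_pinfty; apply: lte_add_pinfty.
Qed.

Lemma measurable_wave_phase (k : d.-tuple int) :
  measurable_fun setT (fun x : torus R d => wave_phase k x).
Proof.
apply: measurable_sum => i.
by apply: measurable_funM => //; exact: measurable_tnth.
Qed.

Lemma integrable_modulated u (a b : torus R d -> R) : cmeasurable u ->
  square_integrable u ->
  measurable_fun setT a -> measurable_fun setT b ->
  (forall x, `|a x| <= 1) -> (forall x, `|b x| <= 1) ->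
  mu.-integrable setT
    (fun x => (complex.Re (u x) * a x - complex.Im (u x) * b x)%:E).
Proof.
move=> cu su ma mb a1 b1; have [mr mi] := cu.
have c1 : mu.-integrable setT (fun x => (1 + sqmod (u x))%:E).
  under eq_fun do rewrite EFinD.
  apply: integrableD => //.
    exact: finite_measure_integrable_cst.
  apply/integrableP; split.
    by apply/measurable_EFinP; exact: (measurable_sqmod cu).
  under eq_integral do rewrite gee0_abs ?lee_fin ?sqmod_ge0 //.
  exact: su.
apply: (le_integrable measurableT _ _ c1) => //.
  by apply/measurable_EFinP/measurable_funB; apply: measurable_funM.
move=> x _ /=; rewrite lee_fin.
rewrite [leRHS]ger0_norm; last by rewrite addr_ge0 ?sqmod_ge0.
apply: (le_trans (ler_normB _ _)); rewrite !normrM.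
apply: (@le_trans _ _ (`|complex.Re (u x)| + `|complex.Im (u x)|)).
  by apply: lerD; rewrite ler_piMr.
rewrite /sqmod -(real_normK (num_real (complex.Re (u x)))).
rewrite -(real_normK (num_real (complex.Im (u x)))).
have := sqr_ge0 (2 * `|complex.Re (u x)| - 1).
have := sqr_ge0 (2 * `|complex.Im (u x)| - 1).
by rewrite !expr2; lra.
Qed.

Lemma ReM_cis z (t : R) :
  complex.Re (z * cis t) = complex.Re z * cos t - complex.Im z * sin t.
Proof. by case: z. Qed.

Lemma ImM_cis z (t : R) :
  complex.Im (z * cis t) = complex.Re z * sin t - complex.Im z * - cos t.
Proof. by case: z => a b /=; rewrite mulrN opprK. Qed.

Lemma fourier_coefB u v : cmeasurable u -> cmeasurable v ->
  square_integrable u -> square_integrable v ->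
  forall k, fourier_coef (u - v) k = fourier_coef u k - fourier_coef v k.
Proof.
move=> cu cv su sv k.
have mp := measurable_funN (measurable_wave_phase k).
have mc : measurable_fun setT (fun x : torus R d => cos (- wave_phase k x)).
  exact: measurableT_comp (continuous_measurable_fun (@continuous_cos R)) mp.
have ms : measurable_fun setT (fun x : torus R d => sin (- wave_phase k x)).
  exact: measurableT_comp (continuous_measurable_fun (@continuous_sin R)) mp.
have c1 x : `|cos (- wave_phase k x) : R| <= 1 by rewrite ler_norml cos_geN1 cos_le1.
have s1 x : `|sin (- wave_phase k x) : R| <= 1 by rewrite ler_norml sin_geN1 sin_le1.
have nc1 x : `|- cos (- wave_phase k x) : R| <= 1 by rewrite normrN.
have mnc := measurable_funN mc.
rewrite /fourier_coef /cintegral /GRing.add/= /GRing.opp/=; congr Complex.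
- rewrite -RintegralB //.
  + by apply: eq_Rintegral => x _; rewrite !ReM_cis ReB ImB !mulrBl; ring.
  + under eq_fun do rewrite /= ReM_cis.
    exact: integrable_modulated.
  + under eq_fun do rewrite /= ReM_cis.
    exact: integrable_modulated.
- rewrite -RintegralB //.
  + by apply: eq_Rintegral => x _; rewrite !ImM_cis ReB ImB !mulrBl; ring.
  + under eq_fun do rewrite /= ImM_cis.
    exact: integrable_modulated.
  + under eq_fun do rewrite /= ImM_cis.
    exact: integrable_modulated.
Qed.

Lemma in_sobolev0 alpha : in_sobolev alpha (0 : torus R d -> R[i]).
Proof.
split; [exact: cmeasurable0 | exact: square_integrable0 |].
rewrite /sobolev_sqnorm esum1 ?ltry // => k _.
suff -> : fourier_coef (0 : torus R d -> R[i]) k = 0.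
  by rewrite /sqmod /= expr0n addr0 mulr0.
rewrite /fourier_coef /cintegral.
by congr Complex; under eq_Rintegral do rewrite mul0r /=;
  rewrite /Rintegral integral0.
Qed.

Lemma in_sobolevB alpha u v :
  in_sobolev alpha u -> in_sobolev alpha v -> in_sobolev alpha (u - v).
Proof.
move=> [cu su hu] [cv sv hv].
split; [exact: cmeasurableB | exact: square_integrableB |].
pose w (k : d.-tuple int) : R := (1 + sqfreq R k) `^ alpha.
pose e (f : torus R d -> R[i]) (k : d.-tuple int) := (w k * sqmod (fourier_coef f k))%:E.
have e0 (f : torus R d -> R[i]) k : (0 <= e f k)%E.
  by rewrite lee_fin mulr_ge0 ?powR_ge0 ?sqmod_ge0.
apply: (@le_lt_trans _ _ (\esum_(k in [set: d.-tuple int])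
    ((e u k + e u k) + (e v k + e v k)))%E).
  apply: le_esum => k _.
  rewrite /e -!EFinD lee_fin fourier_coefB // -!mulrDr.
  by rewrite ler_wpM2l ?powR_ge0 // sqmodB_le.
rewrite esumD; [|by move=> k _; rewrite adde_ge0..].
rewrite !esumD //.
by apply: lte_add_pinfty; apply: lte_add_pinfty.
Qed.

End Closure.

Definition sobolev_pred (R : realType) (d : nat) (alpha : R) :
    {pred torus R d -> R[i]} :=
  mem [set u | in_sobolev alpha u].

Lemma sobolev_zmod_closed (R : realType) (d : nat) (alpha : R) :
  zmod_closed (@sobolev_pred R d alpha).
Proof.
split => [|u v]; rewrite !inE /=; first exact: in_sobolev0.
exact: in_sobolevB.
Qed.

HB.instance Definition _ (R : realType) (d : nat) (alpha : R) :=
  GRing.isZmodClosed.Build (torus R d -> R[i]) (@sobolev_pred R d alpha)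
    (@sobolev_zmod_closed R d alpha).

Record sobolev_fun (R : realType) (d : nat) (alpha : R) := SobolevFun {
  sobolev_val :> torus R d -> R[i];
  _ : sobolev_val \in @sobolev_pred R d alpha }.

HB.instance Definition _ (R : realType) (d : nat) (alpha : R) :=
  [isSub for @sobolev_val R d alpha].
HB.instance Definition _ (R : realType) (d : nat) (alpha : R) :=
  [Choice of sobolev_fun d alpha by <:].
HB.instance Definition _ (R : realType) (d : nat) (alpha : R) :=
  [SubChoice_isSubZmodule of sobolev_fun d alpha by <:].

Definition ae_null (R : realType) (d : nat) (alpha : R) :
    {pred sobolev_fun d alpha} :=
  mem [set u : sobolev_fun d alpha | {ae haar R d, forall x, u x = 0}].

Lemma ae_null_zmod_closed (R : realType) (d : nat) (alpha : R) :
  zmod_closed (@ae_null R d alpha).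
Proof.
split => [|u v]; rewrite !inE /=; first by apply: aeW.
move=> u0 v0; apply: filterS2 u0 v0 => x ux vx.
by rewrite /GRing.add /GRing.opp /= ux vx subr0.
Qed.

HB.instance Definition _ (R : realType) (d : nat) (alpha : R) :=
  GRing.isZmodClosed.Build (sobolev_fun d alpha) (@ae_null R d alpha)
    (@ae_null_zmod_closed R d alpha).

(* H^alpha(T^d): functions modulo almost everywhere equality. *)
Definition sobolev (R : realType) (d : nat) (alpha : R) : zmodType :=
  Quotient.quot (@ae_null R d alpha).

Definition fhat (R : realType) (d : nat) (alpha : R) (u : sobolev d alpha) :
    d.-tuple int -> R[i] :=
  fourier_coef (repr u : sobolev_fun d alpha).

(* The Fourier multiplier with symbol [m]: for a bounded symbol the element with
   Fourier coefficients [m k * fhat u k] exists by Riesz-Fischer and is unique by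
   completeness of the trigonometric system; the default value 0 is then never
   used. *)
Definition fourier_multiplier (R : realType) (d : nat) (alpha : R)
    (m : d.-tuple int -> R[i]) (u : sobolev d alpha) : sobolev d alpha :=
  xget 0 [set v : sobolev d alpha | forall k, fhat v k = m k * fhat u k].

(* The operator e^{i t Delta}. *)
Definition schrodinger (R : realType) (d : nat) (alpha : R) (t : R) :
    sobolev d alpha -> sobolev d alpha :=
  fourier_multiplier (fun k => cis (- (t * sqfreq R k))).

(* [two_step_flow Phit tau v w] is the next iterate when v is the current one
   and w the previous one. *)
Definition two_step_flow (R : realType) (d : nat) (alpha : R)
    (Phit : R -> sobolev d alpha -> sobolev d alpha) (tau : R)
    (v w : sobolev d alpha) : sobolev d alpha :=
  schrodinger (2 * tau) w + Phit tau v
    - schrodinger (2 * tau) (Phit (- tau) v).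

Definition symmetric_two_step (R : realType) (d : nat) (alpha : R)
    (Psi : R -> sobolev d alpha -> sobolev d alpha -> sobolev d alpha) : Prop :=
  forall (tau : R) (v w : sobolev d alpha), w = Psi (- tau) v (Psi tau v w).

(* Main.v *)
(** Writing S_t for e^{it Delta}, the scheme telescopes once S_t is known to be
    additive with S_(-t) S_t = 1. On Fourier coefficients this is immediate, so
    the content is that [u |-> fhat u] is injective and that the multiplier has a
    value with the prescribed coefficients.

    Uniqueness: call a bounded function P a multiplier of the annihilator if
    f P is orthogonal to all waves whenever the integrable f is. These P form
    an algebra which contains the waves and is closed under bounded pointwise
    limits, hence under |P| and the indicator of [0 < P]. Since
    sin x (1 - cos q) - sin q (1 - cos x) is positive on (0, 2 pi) exactly for
    x < q, they contain all indicators of measurable sets E, so that an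
    annihilated f has integral 0 over every E.

    Existence (Riesz-Fischer): along finite frequency sets with tails at most
    4^-n the partial sums converge almost everywhere, and Fatou's lemma makes
    the limit an L^2 limit. *)

Require Import Defs.
From HB Require Import structures.
From mathcomp Require Import all_boot all_order all_algebra.
From mathcomp Require Import complex.
From mathcomp Require Import all_classical all_reals all_analysis.
From mathcomp Require Import measurable_realfun ring lra.

Set Implicit Arguments.
Unset Strict Implicit.
Unset Printing Implicit Defensive.

Import Order.TTheory GRing.Theory Num.Theory.

Import numFieldNormedType.Exports.

Local Open Scope ring_scope.
Local Open Scope classical_set_scope.

(** * Orthogonality of the waves *)

Lemma integrable_bounded_prob d (T : measurableType d) (R : realType)
    (P : probability T R) (f : T -> R) (C : R) :
  measurable_fun setT f -> (forall x, `|f x| <= C) ->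
  P.-integrable setT (EFin \o f).
Proof.
move=> mf fC; apply: measurable_bounded_integrable => //.
  by apply: (le_lt_trans (probability_le1 P measurableT)); rewrite ltry.
by exists C; split; [exact: num_real | move=> M CM x _; exact: le_trans (fC x) (ltW CM)].
Qed.

Lemma sin_add_int_2pi (R : realType) (t : R) (k : int) :
  sin (t + k%:~R * (2 * pi)) = sin t.
Proof.
have E (n : nat) (s : R) : sin (s + n%:R * (2 * pi)) = sin s.
  rewrite -[RHS](periodicn (@sinD2pi R) n s); congr (sin (_ + _)).
  by rewrite -[pi *+ 2]mulr_natl -[RHS]mulr_natl.
case: k => n; first exact: E.
by rewrite NegzE mulrNz mulNr -[LHS](E n.+1) subrK.
Qed.

(** Integrals against the uniform law are computed for nonnegative integrands, so for [k != 0] the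
    fundamental theorem of calculus is applied to [1 + cos (t + r * x)], and the constant 1 is
    removed at the end. *)
Lemma integral_circle_cos (R : realType) (k : int) (t : R) :
  (\int[circle_measure R]_x cos (t + k%:~R * x)) = if k == 0 then cos t else 0.
Proof.
have [->|k0] := eqVneq k 0.
  under eq_Rintegral do rewrite mul0r addr0.
  by rewrite Rintegral_cst // [X in fine X]probability_setT mulr1.
pose r : R := k%:~R.
have r0 : r != 0 by rewrite intr_eq0.
have cc : continuous (fun x : R => 1 + cos (t + r * x)).
  move=> x; apply: cvgD; first exact: cvg_cst.
  apply: continuous_comp; last exact: continuous_cos.
  by apply: cvgD; [exact: cvg_cst | apply: cvgM; [exact: cvg_cst | exact: cvg_id]].
have mc := continuous_measurable_fun cc.
have cc' : continuous (fun x : R => cos (t + r * x)).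
  move=> x; apply: continuous_comp; last exact: continuous_cos.
  by apply: cvgD; [exact: cvg_cst | apply: cvgM; [exact: cvg_cst | exact: cvg_id]].
have mc' := continuous_measurable_fun cc'.
pose F := fun x : R => x + r^-1 * sin (t + r * x).
have dF (x : R) : is_derive x (1 : R) F (1 + cos (t + r * x)).
  rewrite /F; apply: is_derive_eq.
  by rewrite /GRing.scale /=; field.
have E : (\int[circle_measure R]_x (1 + cos (t + r * x))%:E = 1)%E.
  rewrite integral_uniform; last 2 first.
  - exact/measurable_EFinP.
  - by move=> x; rewrite lee_fin; have := cos_geN1 (t + r * x); lra.
  rewrite (@continuous_FTC2 _ _ F) ?twopi_gt0 //.
  - rewrite -EFinB -EFinM subr0 /F mulr0 !addr0 sin_add_int_2pi.
    by rewrite add0r addrK mulVf // gt_eqF // twopi_gt0.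
  - exact: continuous_subspaceT.
  - split.
    + by move=> x _; apply: ex_derive.
    + apply: cvg_at_right_filter; apply: differentiable_continuous.
      by apply/derivable1_diffP; apply: ex_derive.
    + apply: cvg_at_left_filter; apply: differentiable_continuous.
      by apply/derivable1_diffP; apply: ex_derive.
  - by move=> x _; rewrite derive1E; apply: derive_val.
have ic : (circle_measure R).-integrable setT (EFin \o (fun x : R => cos (t + r * x))).
  by apply: (@integrable_bounded_prob _ _ _ _ _ 1) => // x; rewrite ler_norml cos_geN1 cos_le1.
have : \int[circle_measure R]_x (1 + cos (t + r * x)) = 1 by rewrite /Rintegral E.
rewrite RintegralD //; last first.
  by apply: (@integrable_bounded_prob _ _ _ _ (cst 1) 1) => // x; rewrite normr1.
rewrite Rintegral_cst // [X in fine X]probability_setT mulr1 => h.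
by move: h => /(canRL (addKr _)); rewrite addNr.
Qed.

Lemma measurable_cos_phase (R : realType) (d : nat) (k : d.-tuple int) (t : R) :
  measurable_fun setT (fun x : torus R d => cos (t + wave_phase k x)).
Proof.
apply: (measurableT_comp (continuous_measurable_fun (@continuous_cos R))).
by apply: measurable_funD => //; exact: measurable_wave_phase.
Qed.

(** Fubini and induction on [d]: the first coordinate is absorbed into the phase, so the induction
    needs an arbitrary [t]. The free phase also covers sines. *)
Lemma haar_cos (R : realType) (d : nat) (k : d.-tuple int) (t : R) :
  \int[haar R d]_x cos (t + wave_phase k x) =
  if k == [tuple 0 | i < d] then cos t else 0.
Proof.
elim: d k t => [|d IH] k t.
  have -> : k == [tuple 0 | i < 0] by apply/eqP/eq_from_tnth; case.
  under eq_Rintegral do rewrite /wave_phase big_ord0 addr0.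
  by rewrite Rintegral_cst // [X in fine X]probability_setT mulr1.
pose f (p : measurableTypeR R * torus R d) : R :=
  cos (t + wave_phase k (torus_cons p)).
have mf : measurable_fun setT f.
  exact: measurableT_comp (measurable_cos_phase k t) (@measurable_torus_cons R d).
have f1 p : `|f p| <= 1 by rewrite ler_norml cos_geN1 cos_le1.
have iff : (circle_measure R \x haar R d)%E.-integrable setT (EFin \o f).
  exact: (@integrable_bounded_prob _ _ _ (circle_measure R \x haar R d)%E _ 1).
pose k' := behead_tuple k.
have fE p : f p = cos ((t + (thead k)%:~R * p.1) + wave_phase k' p.2).
  rewrite /f /wave_phase big_ord_recl addrA.
  congr (cos (_ + _ * _ + _)).
  apply: eq_bigr => i _; congr (_%:~R * _).
    by rewrite tnth_behead; congr tnth; apply/val_inj; rewrite /= inordK // ltnS.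
  by rewrite /torus_cons tnthS.
rewrite /Rintegral integral_distribution; last 2 first.
- by apply/measurable_EFinP; exact: measurable_cos_phase.
- exact: iff.
rewrite -integral12_prod_meas1 // /fubini_F.
have inner x : (\int[haar R d]_y (EFin \o f) (x, y) =
   (if k' == [tuple 0 | i < d] then cos (t + (thead k)%:~R * x) else 0)%:E)%E.
  rewrite -IH /Rintegral fineK; last first.
    apply: integrable_fin_num => //.
    apply: (@integrable_bounded_prob _ _ _ _ _ 1); first exact: measurable_cos_phase.
    by move=> y; rewrite ler_norml cos_geN1 cos_le1.
  by apply: eq_integral => y _ /=; rewrite fE.
under eq_integral do rewrite inner.
have kE : (k == [tuple 0 | i < d.+1]) = (thead k == 0) && (k' == [tuple 0 | i < d]).
  apply/eqP/andP => [k0|[/eqP h1 /eqP h2]].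
    rewrite /k' k0; split; first by rewrite /thead tnth_mktuple.
    by apply/eqP/eq_from_tnth => i; rewrite tnth_behead !tnth_mktuple.
  apply: eq_from_tnth => i; rewrite tnth_mktuple.
  have [j ->|->] := unliftP ord0 i; last exact: h1.
  have := congr1 (fun z => tnth z j) h2.
  rewrite tnth_behead tnth_mktuple => <-; congr tnth.
  by apply/val_inj; rewrite /= inordK // ltnS.
rewrite kE; case: (k' == _); rewrite ?andbT ?andbF.
  exact: integral_circle_cos.
by rewrite integral0.
Qed.

(** * Uniqueness of Fourier coefficients *)

(** By induction, the preimage under [torus_cons] is a rectangle with one full side. *)
Lemma haar_coordinate (R : realType) (d : nat) (i : 'I_d)
    (A : set (measurableTypeR R)) : measurable A ->
  haar R d [set x | A (tnth x i)] = circle_measure R A.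
Proof.
move=> mA; elim: d i => [|d IH] i; first by case: i.
have mX (j : 'I_d) : measurable [set x : torus R d | A (tnth x j)].
  by rewrite -[X in measurable X]setTI; exact: measurable_tnth.
rewrite /= /distribution /pushforward /=.
have [j ->|->] := unliftP ord0 i.
  rewrite (_ : _ @^-1` _ = [set: measurableTypeR R] `*` [set x | A (tnth x j)]).
    rewrite product_measure1E // -(IH j).
    by rewrite -[RHS]mul1e; congr (_ * _)%E; exact: probability_setT.
  by apply/seteqP; split => -[a b] /=; rewrite /torus_cons tnthS //; case.
rewrite (_ : _ @^-1` _ = A `*` [set: torus R d]).
  rewrite product_measure1E // -[RHS]mule1; congr (_ * _)%E.
  exact: probability_setT.
by apply/seteqP; split => -[a b] //=; case.
Qed.

Lemma circle_measure_itvoo (R : realType) :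
  circle_measure R `]0, (2 * pi)[ = 1%E.
Proof.
transitivity (\int[lebesgue_measure]_(x in `]0%R, (2 * pi : R)%R[)
    (uniform_pdf 0 (2 * pi) x)%:E)%E; first by [].
rewrite (eq_integral (fun=> (2 * pi : R)^-1%:E)); last first.
  move=> x; rewrite inE /= in_itv /= /uniform_pdf subr0 => /andP[x0 x1].
  by rewrite !ltW.
rewrite integral_cst //= lebesgue_measure_itv /= lte_fin twopi_gt0.
by rewrite -EFinD -EFinM subr0 mulVf // gt_eqF // twopi_gt0.
Qed.

(** Points of [torus R d] range over all of R^d; this confines them to the open cell, where sines of
    half coordinates are positive. *)
Lemma haar_ae_itvoo (R : realType) (d : nat) (i : 'I_d) :
  {ae haar R d, forall x, 0 < tnth x i < 2 * pi}.
Proof.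
have mI : measurable (`]0, (2 * pi)[ : set (measurableTypeR R)) by [].
exists [set x | (~` `]0, (2 * pi)[ : set (measurableTypeR R)) (tnth x i)]; split.
- rewrite -[X in measurable X]setTI; apply: measurable_tnth => //.
  exact: measurableC.
- rewrite haar_coordinate; last exact: measurableC.
  by rewrite probability_setC // circle_measure_itvoo subee.
- by move=> x /=; rewrite in_itv.
Qed.

Lemma integrable_mul_bounded d (T : measurableType d) (R : realType)
    (P : probability T R) (f g : T -> R) (C : R) :
  P.-integrable setT (EFin \o f) -> measurable_fun setT g ->
  (forall x, `|g x| <= C) ->
  P.-integrable setT (EFin \o (fun x => f x * g x)).
Proof.
move=> fi mg gC; have mf := measurable_int _ fi.
have C0 : 0 <= C by apply: le_trans (gC point).
apply: (@le_integrable _ _ _ P _ measurableT _ (fun x => C%:E * (f x)%:E)%E).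
- by apply/measurable_EFinP/measurable_funM => //; exact/measurable_EFinP.
- move=> x _ /=; rewrite lee_fin !normrM (ger0_norm C0) mulrC.
  exact: ler_wpM2r.
- exact: integrableZl.
Qed.

(** * The algebra of multipliers of the annihilator *)

Section WaveMultipliers.
Context (R : realType) (d : nat).
Local Notation mu := (haar R d).
Implicit Types (f P Q : torus R d -> R).

(** With the phase [t] free this covers cosines and sines, hence all Fourier coefficients of the
    real function [f]. *)
Definition orthogonal_to_waves f :=
  mu.-integrable setT (EFin \o f) /\
  forall (k : d.-tuple int) t, \int[mu]_x (f x * cos (t + wave_phase k x)) = 0.

(** The product must again be orthogonal to every wave, not only have integral 0; this makes the
    class stable under products. *)
Definition preserves_orthogonality P :=
  [/\ measurable_fun setT P, exists C, forall x, `|P x| <= C &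
  forall f, orthogonal_to_waves f -> orthogonal_to_waves (fun x => f x * P x)].

Lemma cos_bounded (t : R) : `|cos t| <= 1.
Proof. by rewrite ler_norml cos_geN1 cos_le1. Qed.

Lemma integrable_mul_cos f (k : d.-tuple int) t :
  mu.-integrable setT (EFin \o f) ->
  mu.-integrable setT (EFin \o (fun x => f x * cos (t + wave_phase k x))).
Proof.
move=> fi; apply: (integrable_mul_bounded (C := 1) fi).
  exact: measurable_cos_phase.
by move=> x; exact: cos_bounded.
Qed.

Lemma preserves_cst c : preserves_orthogonality (cst c).
Proof.
split; [exact: measurable_cst | by exists `|c| |].
move=> f [fi fo]; split.
  exact: (integrable_mul_bounded (g := cst c) (C := `|c|) fi).
move=> k t; under eq_Rintegral do rewrite /= mulrAC.
rewrite RintegralZr //; first by rewrite fo mul0r.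
exact: integrable_mul_cos.
Qed.

Lemma preservesD P Q : preserves_orthogonality P -> preserves_orthogonality Q ->
  preserves_orthogonality (fun x => P x + Q x).
Proof.
move=> [mP [C PC] hP] [mQ [D QD] hQ]; split.
- exact: measurable_funD.
- by exists (C + D) => x; rewrite (le_trans (ler_normD _ _)) // lerD.
move=> f fo; have [Pi Po] := hP _ fo; have [Qi Qo] := hQ _ fo; split.
  have := integrableD measurableT Pi Qi; apply: eq_integrable => // x _ /=.
  by rewrite mulrDr EFinD.
move=> k t; under eq_Rintegral do rewrite mulrDr mulrDl.
rewrite RintegralD ?Po ?Qo ?addr0 //.
- exact: integrable_mul_cos.
- exact: integrable_mul_cos.
Qed.

Lemma preservesM P Q : preserves_orthogonality P -> preserves_orthogonality Q ->
  preserves_orthogonality (fun x => P x * Q x).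
Proof.
move=> [mP [C PC] hP] [mQ [D QD] hQ]; split.
- exact: measurable_funM.
- by exists (C * D) => x; rewrite normrM ler_pM.
by move=> f /hP /hQ; under eq_fun do rewrite -mulrA.
Qed.

Lemma preservesX P n : preserves_orthogonality P ->
  preserves_orthogonality (fun x => P x ^+ n).
Proof.
move=> hP; elim: n => [|n IH]; first exact: preserves_cst.
by under eq_fun do rewrite exprS; exact: preservesM.
Qed.

Lemma preservesZ c P : preserves_orthogonality P ->
  preserves_orthogonality (fun x => c * P x).
Proof. by apply: preservesM; exact: preserves_cst. Qed.

(** A product of two waves is half the sum of the waves of frequencies [l + k] and [l - k], to both
    of which [f] is orthogonal. *)
Lemma preserves_cos (l : d.-tuple int) s :
  preserves_orthogonality (fun x => cos (s + wave_phase l x)).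
Proof.
split; [exact: measurable_cos_phase | by exists 1 => x; exact: cos_bounded |].
move=> f [fi fo]; split.
  exact: integrable_mul_cos.
move=> k t.
pose p : d.-tuple int := [tuple tnth l i + tnth k i | i < d].
pose m : d.-tuple int := [tuple tnth l i - tnth k i | i < d].
have pE x : wave_phase p x = wave_phase l x + wave_phase k x.
  rewrite /wave_phase -big_split; apply: eq_bigr => i _ /=.
  by rewrite tnth_mktuple intrD mulrDl.
have mE x : wave_phase m x = wave_phase l x - wave_phase k x.
  rewrite /wave_phase -sumrB; apply: eq_bigr => i _ /=.
  by rewrite tnth_mktuple intrB mulrBl.
have E x : f x * cos (s + wave_phase l x) * cos (t + wave_phase k x) =
  2^-1 * (f x * cos ((s + t) + wave_phase p x) + f x * cos ((s - t) + wave_phase m x)).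
  rewrite -mulrDr pE mE.
  rewrite (_ : s + t + _ = (s + wave_phase l x) + (t + wave_phase k x)); last by ring.
  rewrite (_ : s - t + _ = (s + wave_phase l x) - (t + wave_phase k x)); last by ring.
  by move: (s + _) (t + _) => a b; rewrite cosD cosB; field.
under eq_Rintegral do rewrite E.
have i1 := integrable_mul_cos p (s + t) fi.
have i2 := integrable_mul_cos m (s - t) fi.
rewrite RintegralZl //; last exact: (integrableD measurableT i1 i2).
by rewrite RintegralD // !fo addr0 mulr0.
Qed.

(** Dominated convergence with majorant [C * |f|]: the integrals along the sequence all vanish,
    hence so does the limit. *)
Lemma preserves_lim (P_ : nat -> torus R d -> R) P C :
  (forall n, preserves_orthogonality (P_ n)) -> (forall n x, `|P_ n x| <= C) ->
  measurable_fun setT P -> (forall x, `|P x| <= C) ->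
  {ae mu, forall x, P_ ^~ x @ \oo --> P x} ->
  preserves_orthogonality P.
Proof.
move=> hP_ P_C mP PC P_P; split => //; first by exists C.
move=> f fo; have [fi fo'] := fo; split.
  exact: integrable_mul_bounded PC.
move=> k t; set w := fun x => cos (t + wave_phase k x).
have mw : measurable_fun setT w by exact: measurable_cos_phase.
have w1 x : `|w x| <= 1 by exact: cos_bounded.
have mf : measurable_fun setT f by apply/measurable_EFinP; exact: measurable_int fi.
have mP_ n : measurable_fun setT (P_ n) by have [] := hP_ n.
have C0 : 0 <= C by apply: le_trans (PC point).
have fin (g : torus R d -> R) : preserves_orthogonality g ->
    (\int[mu]_x (f x * g x * w x)%:E = 0)%E.
  move=> [_ _ /(_ f fo) [gi go]].
  rewrite -[LHS]fineK; first by congr EFin; exact: go.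
  exact: (integrable_fin_num _ (integrable_mul_cos k t gi)).
have [|||||_ _ h] := @dominated_convergence _ _ _ mu setT measurableT
  (fun n x => (f x * P_ n x * w x)%:E) (fun x => (f x * P x * w x)%:E)
  (fun x => C%:E * `|f x|%:E)%E.
- move=> n; apply/measurable_EFinP; apply: measurable_funM => //.
  exact: measurable_funM.
- apply/measurable_EFinP; apply: measurable_funM => //.
  exact: measurable_funM.
- apply: filterS P_P => x Px _; apply: cvg_EFin; first exact: nearW.
  by apply: cvgM; [apply: cvgM => //; exact: cvg_cst | exact: cvg_cst].
- apply: integrableZl => //; exact: (integrable_norm fi).
- apply: aeW => x n _; rewrite -EFinM lee_fin !normrM [leRHS]mulrC -mulrA.
  by rewrite ler_wpM2l // -[C]mulr1 ler_pM.
have E0 : [sequence (\int[mu]_x (f x * P_ n x * w x)%:E)%E]_n = cst 0%E.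
  by apply/funext => n; exact: fin.
rewrite E0 in h.
have := cvg_unique _ h (cvg_cst 0%E); rewrite /Rintegral => -> //.
Qed.

(** With [y = (P / D)^2] in [0, 1], the polynomials [1 - (1 - y)^n] tend to 0 where [P] vanishes and
    to 1 elsewhere. *)
Lemma preserves_neq0 P : preserves_orthogonality P ->
  preserves_orthogonality (fun x => (P x != 0)%:R).
Proof.
move=> hP; have [mP [C PC] _] := hP.
pose D := `|C| + 1; have D0 : 0 < D by rewrite ltr_wpDl.
pose y x := (D^-1 * P x) ^+ 2.
have y01 x : 0 <= 1 - y x <= 1.
  rewrite /y lerBlDr lerDl sqr_ge0 andbT subr_ge0 -[_ ^+ 2]ger0_norm ?sqr_ge0 //.
  rewrite normrX exprn_ile1 // normrM gtr0_norm ?invr_gt0 //.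
  rewrite ler_pdivrMl // mulr1 (le_trans (PC x)) // /D.
  by rewrite (le_trans (ler_norm C)) // lerDl.
apply: (@preserves_lim (fun n x => 1 + -1 * (1 + -1 * y x) ^+ n) _ 1).
- move=> n; apply: preservesD; first exact: preserves_cst.
  apply: preservesZ; apply: preservesX; apply: preservesD; first exact: preserves_cst.
  by apply: preservesZ; apply: preservesX; apply: preservesZ.
- move=> n x; rewrite !mulN1r.
  have /andP[a b] := y01 x.
  have c := exprn_ge0 n a; have e : (1 - y x) ^+ n <= 1 by exact: exprn_ile1.
  by rewrite ler_norml; lra.
- apply: (measurableT_comp (f := fun b : bool => b%:R : R)) => //.
  by apply: measurable_neg; exact: measurable_fun_eqr.
- by move=> x; case: (_ != _); rewrite ?normr0 ?normr1.
apply: aeW => x; case: eqVneq => [Px0|Px0] /=.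
  apply: cvg_near_cst; apply: nearW => n.
  by rewrite /y Px0 mulr0 expr0n /= mulr0 addr0 expr1n mulN1r subrr.
rewrite -[X in _ --> X](_ : 1 + -1 * 0 = 1 :> R); last by rewrite mulr0 addr0.
apply: cvgD; first exact: cvg_cst.
apply: cvgM; first exact: cvg_cst.
have /andP[a b] := y01 x.
apply: cvg_expr; rewrite mulN1r ger0_norm // ltrBlDr ltrDl /y.
by rewrite exprn_even_gt0 //= mulf_neq0 // invr_eq0 gt_eqF.
Qed.

(* Polynomials in [z] that increase to [a = `|z|]: the step s |-> s' satisfies
   [a - s' = (a - s) * (1 - (a + s) / 2)]. *)
Fixpoint abs_iter (n : nat) (z : R) : R :=
  if n is m.+1 then abs_iter m z + 2^-1 * (z ^+ 2 + -1 * abs_iter m z ^+ 2) else 0.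

Lemma abs_iter_bounds n z : `|z| <= 1 ->
  0 <= abs_iter n z <= `|z| /\ `|z| - abs_iter n z <= `|z| * (1 - 2^-1 * `|z|) ^+ n.
Proof.
move=> z1; elim: n => [|n [/andP[s0 sz] IH]] /=.
  by rewrite lexx normr_ge0 expr0 mulr1 subr0.
have z0 := normr_ge0 z; rewrite -(real_normK (num_real z)).
set s := abs_iter n z in s0 sz IH *; set a := `|z| in z1 z0 s0 sz IH *.
(* As [0 <= s <= a <= 1], the factor lies between 0 and [1 - a / 2]: the iterate stays below [a] and
   the error shrinks geometrically. *)
have E : a - (s + 2^-1 * (a ^+ 2 + -1 * s ^+ 2)) = (a - s) * (1 - 2^-1 * (a + s)).
  by field.
have c0 : 0 <= 1 - 2^-1 * (a + s) by lra.
have as0 : 0 <= a - s by rewrite subr_ge0.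
split.
  apply/andP; split; last by rewrite -subr_ge0 E mulr_ge0.
  have : 0 <= (a - s) * (a + s) by rewrite mulr_ge0 // addr_ge0.
  by rewrite -subr_sqr; lra.
rewrite E exprSr mulrA; apply: ler_pM => //; lra.
Qed.

Lemma cvg_abs_iter z : `|z| <= 1 -> abs_iter ^~ z @ \oo --> `|z|.
Proof.
move=> z1; have z0 := normr_ge0 z.
have h : (fun n => `|z| * (1 - 2^-1 * `|z|) ^+ n) @ \oo --> (0 : R).
  (* At [z = 0] the ratio is 1 and only the prefactor makes the bound vanish. *)
  have [->|nz0] := eqVneq `|z| 0.
    by under eq_fun do rewrite mul0r; exact: cvg_cst.
  have zp : 0 < `|z| by rewrite lt_neqAle eq_sym nz0.
  rewrite -[X in _ --> X](mulr0 `|z|); apply: cvgM; first exact: cvg_cst.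
  by apply: cvg_expr; rewrite ger0_norm; lra.
have {}h : (fun n => `|z| - abs_iter n z) @ \oo --> (0 : R).
  apply: (squeeze_cvgr _ (cvg_cst 0) h); apply: nearW => n.
  by have [/andP[_ ?] ->] := abs_iter_bounds n z1; rewrite subr_ge0 andbT.
rewrite -[X in _ --> X](subr0 `|z|).
rewrite (_ : abs_iter ^~ z = fun n => `|z| - (`|z| - abs_iter n z)).
  by apply: cvgB => //; exact: cvg_cst.
by apply/funext => n; rewrite opprB addrC subrK.
Qed.

(** After division by [D] the values lie in [-1, 1], where the polynomials [abs_iter n] converge to
    the absolute value. *)
Lemma preserves_abs P : preserves_orthogonality P ->
  preserves_orthogonality (fun x => `|P x|).
Proof.
move=> hP; have [mP [C PC] _] := hP.
pose D := `|C| + 1; have D0 : 0 < D by rewrite ltr_wpDl.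
pose y x := D^-1 * P x.
have y1 x : `|y x| <= 1.
  rewrite normrM gtr0_norm ?invr_gt0 // ler_pdivrMl // mulr1 (le_trans (PC x)) //.
  by rewrite (le_trans (ler_norm C)) // lerDl.
have hy : preserves_orthogonality y by exact: preservesZ.
have [my _ _] := hy.
suff : preserves_orthogonality (fun x => D * `|y x|).
  under eq_fun => x.
    rewrite /y normrM (gtr0_norm (_ : 0 < D^-1)) ?invr_gt0 // mulVKf ?gt_eqF //.
    over.
  by [].
apply: preservesZ; apply: (@preserves_lim (fun n x => abs_iter n (y x)) _ 1).
- elim => [|n IH] /=; first exact: preserves_cst.
  apply: preservesD => //; apply: preservesZ; apply: preservesD.
    exact: preservesX.
  by apply: preservesZ; exact: preservesX.
- move=> n x; have [/andP[a b] _] := abs_iter_bounds n (y1 x).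
  by rewrite ger0_norm // (le_trans b).
- exact: measurableT_comp.
- by move=> x; rewrite normr_id.
- by apply: aeW => x; exact: cvg_abs_iter.
Qed.

(** The function [P + |P|] is nonzero exactly where [P] is positive. *)
Lemma preserves_gt0 P : preserves_orthogonality P ->
  preserves_orthogonality (fun x => (0 < P x)%R%:R).
Proof.
move=> hP.
have := preserves_neq0 (preservesD hP (preserves_abs hP)).
congr preserves_orthogonality; apply/funext => x; congr (nat_of_bool _)%:R.
case: (ltrgt0P (P x)) => [Px|Px|->]; last by rewrite addr0 eqxx.
- by rewrite gt_eqF // addr_gt0.
- by rewrite subrr eqxx.
Qed.

Definition preserving_set (A : set (torus R d)) :=
  preserves_orthogonality (\1_A : torus R d -> R).

Lemma preserving_setC A : preserving_set A -> preserving_set (~` A).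
Proof.
move=> hA; have := preservesD (preserves_cst 1) (preservesZ (-1) hA).
congr preserves_orthogonality; apply/funext => x.
by rewrite indicC indicE mulN1r; case: (_ \in A); rewrite ?subrr ?subr0.
Qed.

Lemma preserving_setI A B :
  preserving_set A -> preserving_set B -> preserving_set (A `&` B).
Proof. by move=> hA hB; rewrite /preserving_set indicI; exact: preservesM. Qed.

Lemma preserving_setU A B :
  preserving_set A -> preserving_set B -> preserving_set (A `|` B).
Proof.
by move=> hA hB; rewrite -[_ `|` _]setCK setCU; apply/preserving_setC/preserving_setI;
  exact: preserving_setC.
Qed.

Lemma preserving_measurable A : preserving_set A -> measurable A.
Proof. by case=> /measurable_indicP. Qed.

Lemma preserving_set0 : preserving_set set0.
Proof. by rewrite /preserving_set indic0; exact: preserves_cst. Qed.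

(** Complements and finite unions are algebraic; a countable union is the bounded pointwise limit of
    its finite unions. *)
Lemma preserving_sigma_algebra : sigma_algebra setT preserving_set.
Proof.
split; first exact: preserving_set0.
  by move=> A; rewrite setTD; exact: preserving_setC.
move=> A hA.
apply: (@preserves_lim (fun n => \1_(\bigcup_(i < n) A i)) _ 1).
- elim=> [|n IH]; first by rewrite bigcup_mkord big_ord0; exact: preserving_set0.
  rewrite bigcup_mkord big_ord_recr -bigcup_mkord.
  exact: preserving_setU.
- by move=> n x; rewrite indicE; case: (_ \in _); rewrite ?normr0 ?normr1.
- apply: measurable_indic; apply: bigcup_measurable => i _.
  exact: preserving_measurable.
- by move=> x; rewrite indicE; case: (_ \in _); rewrite ?normr0 ?normr1.
apply: aeW => x; apply: cvg_near_cst.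
have [[i _ Aix]|nA] := pselect ((\bigcup_i A i) x).
  exists i.+1 => //= n /= ltin.
  by rewrite !indicE !mem_set //; exists i.
apply: nearW => n; rewrite !indicE !memNset // => -[i _ Aix]; apply: nA.
by exists i.
Qed.

End WaveMultipliers.

(** * Indicators of measurable sets as multipliers *)

Section FourierUniqueness.
Context (R : realType) (d : nat).
Local Notation mu := (haar R d).

Lemma haar_ae_filter : Filter (almost_everywhere mu).
Proof. exact: ae_filter_ringOfSetsType. Qed.
#[local] Existing Instance haar_ae_filter.

(** The constant sequence [\1_A] converges almost everywhere to [\1_B], which is all that
    [preserves_lim] asks. *)
Lemma preserving_ae (A B : set (torus R d)) : preserving_set A -> measurable B ->
  {ae mu, forall x, A x <-> B x} -> preserving_set B.
Proof.
move=> hA mB AB.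
apply: (@preserves_lim _ _ (fun=> \1_A) _ 1) => //.
- by move=> _ x; rewrite indicE; case: (_ \in A); rewrite ?normr0 ?normr1.
- by move=> x; rewrite indicE; case: (_ \in B); rewrite ?normr0 ?normr1.
- apply: filterS AB => x ABx; rewrite !indicE.
  rewrite (_ : (x \in A) = (x \in B)); first exact: cvg_cst.
  by apply/idP/idP; rewrite !inE => /ABx.
Qed.

Lemma preserves_cos_coordinate (i : 'I_d) (t : R) :
  preserves_orthogonality (fun x : torus R d => cos (t + tnth x i)).
Proof.
(* The frequency is the [i]-th unit vector. *)
have := preserves_cos [tuple ((j == i)%:Z) | j < d] t.
congr preserves_orthogonality; apply/funext => x; congr (cos (_ + _)).
rewrite /wave_phase (bigD1 i) //= big1 => [|j /negbTE ji].
  by rewrite tnth_mktuple eqxx mul1r addr0.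
by rewrite tnth_mktuple ji mul0r.
Qed.

(** In half angles, [sin = 2 sin cos] and [1 - cos = 2 sin^2]; the remaining factor is the sine of a
    difference. *)
Lemma sin_half_product (x q : R) :
  sin x * (1 - cos q) - sin q * (1 - cos x) =
  4 * (sin (x / 2) * sin (q / 2) * sin (q / 2 - x / 2)).
Proof.
rewrite [in LHS](_ : x = x / 2 + x / 2); last by field.
rewrite [in LHS](_ : q = q / 2 + q / 2); last by field.
move: (x / 2) (q / 2) => a b.
rewrite !sinD !cosD sinN cosN.
have := cos2Dsin2 a; have := cos2Dsin2 b.
move: (cos a) (sin a) (cos b) (sin b) => ca sa cb sb hb ha.
have -> : cb * cb = 1 - sb ^+ 2 by rewrite -hb; ring.
have -> : ca * ca = 1 - sa ^+ 2 by rewrite -ha; ring.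
by ring.
Qed.

(** Both half angles lie in (0, pi), so the sign is that of [sin (q / 2 - x / 2)], whose argument
    lies in (-pi, pi). *)
Lemma lt_sin_half (x q : R) : 0 < x < 2 * pi -> 0 < q < 2 * pi ->
  (0 < sin x * (1 - cos q) - sin q * (1 - cos x)) = (x < q).
Proof.
move=> /andP[x0 x1] /andP[q0 q1].
rewrite sin_half_product pmulr_rgt0 // pmulr_rgt0; last first.
  by rewrite mulr_gt0 // sin_gt0_pi //; lra.
have [xq|xq] := ltP x q; first by apply: sin_gt0_pi; lra.
rewrite -opprB sinN oppr_gt0; apply/negbTE; rewrite -leNgt.
by apply: sin_ge0_pi; lra.
Qed.

(** For [q] outside (0, 2 pi) the set is almost everywhere empty or full. Otherwise it is almost
    everywhere the positivity set of a trigonometric polynomial. *)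
Lemma preserving_halfspace (i : 'I_d) (q : R) :
  preserving_set [set x : torus R d | tnth x i < q].
Proof.
have mH : measurable [set x : torus R d | tnth x i < q].
  have := @measurable_tnth _ (measurableTypeR R) d i measurableT `]-oo, q[ (measurable_itv _).
  rewrite setTI; congr measurable; apply/seteqP; split => x /=; by rewrite in_itv.
have hI := haar_ae_itvoo R i.
have [q0|q0] := leP q 0.
  apply: (preserving_ae (preserving_set0 _ _)) => //.
  move: hI. apply: filterS => x /andP[x0 _]; split=> //=.
  by move=> /(lt_trans x0); rewrite ltNge q0.
have [q1|q1] := leP (2 * pi) q.
  apply: (@preserving_ae setT) => //.
    by rewrite -setC0; exact/preserving_setC/preserving_set0.
  by move: hI; apply: filterS => x /andP[_ x1]; split=> //= _; exact: lt_le_trans q1.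
pose P (x : torus R d) := sin (tnth x i) * (1 - cos q) - sin q * (1 - cos (tnth x i)).
have hP : preserves_orthogonality P.
  (* The sine is the cosine wave of phase [- (pi / 2)]. *)
  have -> : P = fun x => (1 - cos q) * cos (- (pi / 2) + tnth x i)
      + (- sin q) * (1 + -1 * cos (0 + tnth x i)).
    by apply/funext => x; rewrite add0r [_ + tnth x i]addrC cosBpihalf /P; ring.
  apply: preservesD; apply: preservesZ; first exact: preserves_cos_coordinate.
  apply: preservesD; first exact: preserves_cst.
  by apply: preservesZ; exact: preserves_cos_coordinate.
apply: (@preserving_ae [set x | 0 < P x]) => //.
  have := preserves_gt0 hP; congr preserves_orthogonality.
  by apply/funext => x; rewrite indicE mem_setE.
by move: hI; apply: filterS => x xI; rewrite /P /= lt_sin_half // q0.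
Qed.

(** Preimages under coordinates generate the product sigma-algebra, and open left rays generate the
    Borel sets of each coordinate. *)
Lemma preserving_all (A : set (torus R d)) : measurable A -> preserving_set A.
Proof.
have [h0 hC hU] := preserving_sigma_algebra R d.
apply: smallest_sub; first exact: preserving_sigma_algebra.
rewrite -bigcup_seq => B [i _ [C mC <-]]; rewrite setTI.
suff : (@ocitv R).-sigma.-measurable `<=`
  [set C : set R | preserving_set [set x : torus R d | C (tnth x i)]] by exact.
rewrite (RGenInftyO.measurableE R).
apply: smallest_sub; last first.
  move=> _ [q ->] /=.
  exact: preserving_halfspace i q.
split => //=.
- by move=> D hD; exact: hC hD.
- by move=> F hF; exact: hU hF.
Qed.

Lemma orthogonal_ae0 (f : torus R d -> R) : orthogonal_to_waves f ->
  {ae mu, forall x, f x = 0}.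
Proof.
move=> fo; have [fi _] := fo.
have := @integral_ae_eq _ _ _ mu setT measurableT (fun=> 0%E) (EFin \o f) fi.
move=> h; have {}h := h (measurable_cst _).
suff /h : forall E, E `<=` setT -> measurable E ->
    (\int[mu]_(x in E) (EFin \o f) x = \int[mu]_(x in E) 0)%E.
  by apply: filterS => x /(_ I) /= [].
move=> E _ mE; rewrite integral0.
have [_ _ /(_ f fo) [ei eo]] := preserving_all mE.
(* The wave of zero frequency and phase is the constant 1, so this is the integral of [f] over
   [E]. *)
have := eo [tuple 0 | i < d] 0.
under eq_Rintegral => x _.
  rewrite add0r /wave_phase big1 ?cos0 ?mulr1; last first.
    by move=> i _; rewrite tnth_mktuple mul0r.
  over.
move=> e0.
rewrite integral_mkcond.
rewrite (_ : (_ \_ _) = EFin \o (fun x => f x * \1_E x)).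
  rewrite -[LHS]fineK; first by congr EFin.
  exact: integrable_fin_num.
apply/funext => x /=; rewrite patchE indicE; case: (x \in E) => /=.
  by rewrite mulr1.
by rewrite mulr0.
Qed.

End FourierUniqueness.

(** * Riesz-Fischer *)

Section TrigSum.
Context (R : realType) (d : nat).
Local Notation mu := (haar R d).
Implicit Types (c : d.-tuple int -> R[i]) (z w : R[i]).

Lemma ReD z w : complex.Re (z + w) = complex.Re z + complex.Re w.
Proof. by case: z w => [a b] [e f]. Qed.

Lemma ImD z w : complex.Im (z + w) = complex.Im z + complex.Im w.
Proof. by case: z w => [a b] [e f]. Qed.

Lemma Re_sum (I : Type) (r : seq I) (F : I -> R[i]) :
  complex.Re (\sum_(i <- r) F i) = \sum_(i <- r) complex.Re (F i).
Proof. exact: (big_morph _ ReD). Qed.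

Lemma Im_sum (I : Type) (r : seq I) (F : I -> R[i]) :
  complex.Im (\sum_(i <- r) F i) = \sum_(i <- r) complex.Im (F i).
Proof. exact: (big_morph _ ImD). Qed.

Lemma cisD (s t : R) : cis (s + t) = cis s * cis t.
Proof.
by rewrite /cis cosD sinD /GRing.mul /= [cos s * sin t + _]addrC.
Qed.

Lemma sqmodM z w : sqmod (z * w) = sqmod z * sqmod w.
Proof. by case: z w => [a b] [e f]; rewrite /sqmod /=; ring. Qed.

Lemma sqmod_cis (t : R) : sqmod (cis t) = 1.
Proof. by rewrite /sqmod /= cos2Dsin2. Qed.

Lemma integrable_bigsum (I : Type) (r : seq I) (F : I -> torus R d -> R) :
  (forall i, mu.-integrable setT (EFin \o F i)) ->
  mu.-integrable setT (EFin \o (fun x => \sum_(i <- r) F i x)).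
Proof.
move=> Fi; rewrite (_ : EFin \o _ = fun x => (\sum_(j <- r) (F j x)%:E)%E).
  by apply: (integrable_sum measurableT) => i _; exact: Fi.
by apply/funext => x /=; rewrite sumEFin.
Qed.

Lemma Rintegral_sum (I : Type) (r : seq I) (F : I -> torus R d -> R) :
  (forall i, mu.-integrable setT (EFin \o F i)) ->
  \int[mu]_x (\sum_(i <- r) F i x) = \sum_(i <- r) \int[mu]_x F i x.
Proof.
move=> Fi; elim: r => [|i r IH].
  rewrite big_nil; under eq_Rintegral do rewrite big_nil.
  by rewrite Rintegral_cst // mul0r.
rewrite big_cons -IH -RintegralD //.
  by apply: eq_Rintegral => x _; rewrite big_cons.
exact: integrable_bigsum.
Qed.

Lemma wave_phaseB (k l : d.-tuple int) (x : torus R d) :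
  wave_phase k x - wave_phase l x = wave_phase [tuple tnth k i - tnth l i | i < d] x.
Proof.
rewrite /wave_phase -sumrB; apply: eq_bigr => i _.
by rewrite tnth_mktuple intrB mulrBl.
Qed.

Lemma tuple_sub_eq0 (k l : d.-tuple int) :
  ([tuple tnth k i - tnth l i | i < d] == [tuple 0 | i < d]) = (k == l).
Proof.
apply/eqP/eqP => [h|->]; apply: eq_from_tnth => i; last by rewrite !tnth_mktuple subrr.
by have := congr1 (fun t => tnth t i) h; rewrite !tnth_mktuple => /subr0_eq.
Qed.

(** Puts a complex mode in the form of [haar_cos], with [- sin] written as the cosine of phase
    [pi / 2]. *)
Lemma Re_mode z (k : d.-tuple int) (x : torus R d) :
  complex.Re (z * cis (wave_phase k x)) =
  complex.Re z * cos (0 + wave_phase k x) + complex.Im z * cos (pi / 2 + wave_phase k x).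
Proof.
rewrite ReM_cis add0r cosD cos_pihalf sin_pihalf mul0r mul1r sub0r mulrN.
by [].
Qed.

Lemma integrable_cos_phase (k : d.-tuple int) (t : R) :
  mu.-integrable setT (EFin \o (fun x => cos (t + wave_phase k x))).
Proof.
apply: (@integrable_bounded_prob _ _ _ _ _ 1); first exact: measurable_cos_phase.
by move=> x; exact: cos_bounded.
Qed.

Lemma integrable_scale (a : R) (f : torus R d -> R) :
  mu.-integrable setT (EFin \o f) -> mu.-integrable setT (EFin \o (fun x => a * f x)).
Proof. by move=> fi; exact: (integrableZl measurableT a fi). Qed.

Lemma integrable_Re_mode z (k : d.-tuple int) :
  mu.-integrable setT (EFin \o (fun x => complex.Re (z * cis (wave_phase k x)))).
Proof.
under eq_fun do rewrite Re_mode.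
have h1 := integrable_scale (complex.Re z) (integrable_cos_phase k 0).
have h2 := integrable_scale (complex.Im z) (integrable_cos_phase k (pi / 2)).
exact: (integrableD measurableT h1 h2).
Qed.

Lemma integral_Re_mode z (k : d.-tuple int) :
  \int[mu]_x complex.Re (z * cis (wave_phase k x)) =
  if k == [tuple 0 | i < d] then complex.Re z else 0.
Proof.
under eq_Rintegral do rewrite Re_mode.
have h1 := integrable_scale (complex.Re z) (integrable_cos_phase k 0).
have h2 := integrable_scale (complex.Im z) (integrable_cos_phase k (pi / 2)).
rewrite RintegralD // !RintegralZl //; try exact: integrable_cos_phase.
rewrite !haar_cos cos0 cos_pihalf; case: ifP => _; last by rewrite !mulr0 addr0.
by rewrite mulr1 mulr0 addr0.
Qed.

Definition trig_sum c (G : seq (d.-tuple int)) (x : torus R d) : R[i] :=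
  \sum_(k <- G) c k * cis (wave_phase k x).

Lemma trig_sum_coef c (G : seq (d.-tuple int)) (l : d.-tuple int) : uniq G ->
  fourier_coef (trig_sum c G) l = if l \in G then c l else 0.
Proof.
move=> uG.
have prodE z k x : z * cis (wave_phase k x) * cis (- wave_phase l x) =
    z * cis (wave_phase [tuple tnth k i - tnth l i | i < d] x).
  by rewrite -mulrA -cisD wave_phaseB.
have selE (a : d.-tuple int -> R) :
    \sum_(k <- G) (if k == l then a k else 0) = if l \in G then a l else 0.
  rewrite -big_mkcond /= -big_filter; case: ifP => lG.
    by rewrite filter_pred1_uniq // big_seq1.
  rewrite big_filter big_seq_cond big1 // => k /andP[kG /eqP kl].
  by rewrite kl lG in kG.
have ReC : \int[mu]_x complex.Re (trig_sum c G x * cis (- wave_phase l x)) =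
    if l \in G then complex.Re (c l) else 0.
  rewrite -(selE (fun k => complex.Re (c k))); under eq_Rintegral => x _.
    rewrite /trig_sum mulr_suml Re_sum.
    under eq_bigr do rewrite prodE.
    over.
  rewrite Rintegral_sum; last by move=> k; exact: integrable_Re_mode.
  by apply: eq_bigr => k _; rewrite integral_Re_mode tuple_sub_eq0.
(* Multiplication by [-i] reduces imaginary parts to the integrals already known for real parts. *)
have ImRe z : complex.Im z = complex.Re (Complex 0 (-1) * z).
  by case: z => a b /=; ring.
have ImC : \int[mu]_x complex.Im (trig_sum c G x * cis (- wave_phase l x)) =
    if l \in G then complex.Im (c l) else 0.
  rewrite -(selE (fun k => complex.Im (c k))); under eq_Rintegral => x _.
    rewrite /trig_sum mulr_suml Im_sum.
    under eq_bigr do rewrite prodE ImRe mulrA.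
    over.
  rewrite Rintegral_sum; last by move=> k; exact: integrable_Re_mode.
  by apply: eq_bigr => k _; rewrite integral_Re_mode tuple_sub_eq0 -ImRe.
by rewrite /fourier_coef /cintegral ReC ImC; case: ifP => // _; case: (c l).
Qed.

(** The product of [z] with the conjugate of [w]. *)
Definition herm z w : R[i] :=
  Complex (complex.Re z * complex.Re w + complex.Im z * complex.Im w)
          (complex.Im z * complex.Re w - complex.Re z * complex.Im w).

Lemma sqmod_sum (I : Type) (r : seq I) (F : I -> R[i]) :
  sqmod (\sum_(i <- r) F i) = \sum_(i <- r) \sum_(j <- r) complex.Re (herm (F i) (F j)).
Proof.
rewrite /sqmod Re_sum Im_sum !expr2 !mulr_suml -big_split; apply: eq_bigr => i _ /=.
by rewrite !mulr_sumr -big_split.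
Qed.

Lemma herm_cis z w (s t : R) : herm (z * cis s) (w * cis t) = herm z w * cis (s - t).
Proof.
apply/eqP; case: z w => [a b] [e f]; rewrite eq_complex /= cosB sinB.
by apply/andP; split; apply/eqP; ring.
Qed.

Lemma sqmod_trig_sumE c G x : sqmod (trig_sum c G x) =
  \sum_(k <- G) \sum_(l <- G)
    complex.Re (herm (c k) (c l) * cis (wave_phase [tuple tnth k i - tnth l i | i < d] x)).
Proof.
rewrite sqmod_sum; apply: eq_bigr => k _; apply: eq_bigr => l _.
by rewrite herm_cis wave_phaseB.
Qed.

Lemma integrable_sqmod_trig_sum c G :
  mu.-integrable setT (EFin \o (fun x => sqmod (trig_sum c G x))).
Proof.
under eq_fun do rewrite sqmod_trig_sumE.
by apply: integrable_bigsum => k; apply: integrable_bigsum => l; exact: integrable_Re_mode.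
Qed.

(** In the double sum for the squared modulus only the diagonal terms have zero frequency and
    survive integration. *)
Lemma parseval_trig_sum c G : uniq G ->
  (\int[mu]_x (sqmod (trig_sum c G x))%:E = (\sum_(k <- G) sqmod (c k))%:E)%E.
Proof.
move=> uG; rewrite -[LHS]fineK; last exact: (integrable_fin_num _ (integrable_sqmod_trig_sum _ _)).
congr EFin; rewrite -/(Rintegral _ _ (fun x => sqmod (trig_sum c G x))).
under eq_Rintegral do rewrite sqmod_trig_sumE.
rewrite Rintegral_sum; last first.
  by move=> k; apply: integrable_bigsum => l; exact: integrable_Re_mode.
rewrite big_seq [RHS]big_seq; apply: eq_bigr => k kG.
rewrite Rintegral_sum; last by move=> l; exact: integrable_Re_mode.
rewrite (bigD1_seq k) // integral_Re_mode tuple_sub_eq0 eqxx big1 => [|l /negbTE lk].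
  by rewrite [LHS]addr0 /sqmod !expr2.
by rewrite integral_Re_mode tuple_sub_eq0 eq_sym lk.
Qed.

Lemma cmeasurable_trig_sum c G : cmeasurable (trig_sum c G).
Proof.
split; rewrite /trig_sum.
- under eq_fun do rewrite Re_sum.
  apply: measurable_sum => k.
  by apply/measurable_EFinP; exact: measurable_int (integrable_Re_mode _ _).
- under eq_fun do rewrite Im_sum.
  apply: measurable_sum => k.
  rewrite (_ : (fun x => _) = fun x => complex.Re ((Complex 0 (-1) * c k) * cis (wave_phase k x))).
    by apply/measurable_EFinP; exact: measurable_int (integrable_Re_mode _ _).
  by apply/funext => x; rewrite -mulrA; case: (_ * _) => a b /=; ring.
Qed.

Lemma square_integrable_trig_sum c G : square_integrable (trig_sum c G).
Proof.
have /integrableP[_] := integrable_sqmod_trig_sum c G.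
by under eq_integral do rewrite /= ger0_norm ?sqmod_ge0 //.
Qed.

End TrigSum.

(** * Limits of fast Cauchy sequences in L^2 *)

Section L2.
Context d (T : measurableType d) (R : realType) (P : probability T R).
Implicit Types f : T -> R.

(** Integrate [|f| <= e + f^2 / e] over a probability space; each term contributes at most [e]. *)
Lemma ge0_integral_sqr_le_L1 f (e : R) : measurable_fun setT f -> 0 < e ->
  (\int[P]_x (f x ^+ 2)%:E <= (e ^+ 2)%:E)%E ->
  (\int[P]_x `|f x|%:E <= (2 * e)%:E)%E.
Proof.
move=> mf e0 fe.
have mf2 : measurable_fun setT (fun x => (f x ^+ 2)%:E).
  by apply/measurable_EFinP; exact: measurable_funX.
have f20 x : (0 <= (f x ^+ 2)%:E)%E by rewrite lee_fin sqr_ge0.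
have ei0 : (0 <= (e^-1)%:E)%E by rewrite lee_fin invr_ge0 ltW.
have mZ : measurable_fun setT (fun x => (e^-1)%:E * (f x ^+ 2)%:E)%E.
  by apply: emeasurable_funM => //; exact: measurable_cst.
apply: (@le_trans _ _ (\int[P]_x (e%:E + (e^-1)%:E * (f x ^+ 2)%:E))%E).
  apply: ge0_le_integral => //.
  - by apply/measurable_EFinP; exact: measurableT_comp.
  - by apply: emeasurable_funD => //; exact: measurable_cst.
  - move=> x _; rewrite -EFinM -EFinD lee_fin -(real_normK (num_real (f x))).
    rewrite -subr_ge0.
    have -> : e + e^-1 * `|f x| ^+ 2 - `|f x| =
        e^-1 * ((`|f x| - e / 2) ^+ 2 + 3 / 4 * e ^+ 2).
      by field; rewrite gt_eqF.
    by rewrite mulr_ge0 ?invr_ge0 ?(ltW e0) // addr_ge0 ?sqr_ge0 // mulr_ge0 ?sqr_ge0 //; lra.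
rewrite ge0_integralD //; last 2 first.
- by move=> x _; rewrite lee_fin ltW.
- by move=> x _; rewrite mule_ge0.
rewrite ge0_integralZl // integral_cst // [X in (_ * X)%E]probability_setT mule1.
rewrite mulrDl mul1r EFinD leeD2l //.
apply: (le_trans (lee_wpmul2l ei0 fe)).
by rewrite -EFinM lee_fin expr2 mulKf // gt_eqF.
Qed.

(** Consecutive differences have summable L^1 norms, so the telescoping series converges absolutely
    almost everywhere; Fatou's lemma then carries the Cauchy bound to the limit. *)
Lemma L2_limit (g : nat -> T -> R) :
  (forall n, measurable_fun setT (g n)) ->
  (forall n m, (n <= m)%N ->
     (\int[P]_x ((g m x - g n x) ^+ 2)%:E <= ((2^-1 ^+ n) ^+ 2)%:E)%E) ->
  exists2 h : T -> R, measurable_fun setT h & forall n,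
    (\int[P]_x ((h x - g n x) ^+ 2)%:E <= ((2^-1 ^+ n) ^+ 2)%:E)%E.
Proof.
move=> mg gC.
(* The upper limit is measurable without any convergence; [fine] gives a real value where it is
   infinite, which happens at most on a null set. *)
pose h x := fine (limn_esup (fun n => (g n x)%:E)).
have mh : measurable_fun setT h.
  apply: measurableT_comp => //; apply: measurable_fun_limn_esup => n.
  by apply/measurable_EFinP.
pose u n x := `|g n.+1 x - g n x|%:E.
have mu_ n : measurable_fun setT (u n).
  apply/measurable_EFinP; apply: measurableT_comp => //.
  exact: measurable_funB.
have u0 n x : (0 <= u n x)%E by rewrite lee_fin.
have us : (\int[P]_x (\sum_(n <oo) u n x) < +oo)%E.
  rewrite integral_nneseries //.
  (* The L^1 bound [2 * 2^-n] is rewritten as [4 / 2^(n+1)] to match the geometric series of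
     [epsilon_trick0]. *)
  apply: (@le_lt_trans _ _ (\sum_(n <oo) ((4 / (2 ^ n.+1)%:R)%:E : \bar R)))%E; last first.
    by apply: le_lt_trans (epsilon_trick0 _ _) (ltry 4).
  apply: lee_nneseries => [n _ _|n _]; first exact: integral_ge0.
  have q0 : 0 < 2^-1 ^+ n :> R by rewrite exprn_gt0 // invr_gt0.
  have := @ge0_integral_sqr_le_L1 (fun x => g n.+1 x - g n x) (2^-1 ^+ n) _ q0 (gC _ _ (leqnSn n)).
  move=> /(_ (measurable_funB (mg _) (mg _))) /le_trans; apply.
  rewrite lee_fin natrX exprS exprVn.
  rewrite (_ : 4 = 2 * 2 :> R); last by ring.
  by rewrite invfM mulrACA divff // mul1r.
have gh : {ae P, forall x, g ^~ x @ \oo --> h x}.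
  have iu : P.-integrable setT (fun x => \sum_(n <oo) u n x)%E.
    apply/integrableP; split.
      exact: ge0_emeasurable_sum.
    under eq_integral => x _ do rewrite gee0_abs ?nneseries_ge0 //.
    exact: us.
  apply: filterS (integrable_ae measurableT iu) => x /(_ I) fx.
  have cvgg : cvgn (g ^~ x).
    have : cvgn (series (telescope (g ^~ x))).
      apply: normed_cvg; apply: nondecreasing_is_cvgn.
        by apply: nondecreasing_series => n _ _; exact: normr_ge0.
      exists (fine (\sum_(n <oo) u n x)%E) => _ [n _ <-] /=.
      rewrite -lee_fin fineK // /series /= -sumEFin.
      exact: (@nneseries_lim_ge _ (u ^~ x) xpredT 0 n).
    move=> c; rewrite (_ : g ^~ x = fun n => g 0%N x + series (telescope (g ^~ x)) n).
      by apply: is_cvgD => //; exact: is_cvg_cst.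
    by apply/funext => n; rewrite -(eq_sum_telescope (g ^~ x)).
  have cE : (fun n => (g n x)%:E) @ \oo --> (limn (g ^~ x))%:E.
    by apply: cvg_EFin => //; exact: nearW.
  by rewrite /h is_cvg_limn_esupE; [rewrite (cvg_lim _ cE) | exact: cvgP cE].
exists h => // n.
(* The index is shifted by [n] so that the Cauchy bound holds for every [m]. *)
pose f m x := ((g (m + n)%N x - g n x) ^+ 2)%:E.
have mf m : measurable_fun setT (f m).
  apply/measurable_EFinP; apply: measurable_funX; exact: measurable_funB.
have f0 m x : (0 <= f m x)%E by rewrite lee_fin sqr_ge0.
have F := fatou P measurableT mf (fun m x _ => f0 m x).
rewrite (@ge0_ae_eq_integral _ _ _ P _ _ (fun x => limn_einf (f ^~ x))) //.
- apply: (le_trans F); rewrite limn_einf_lim; apply: lime_le; first exact: is_cvg_einfs.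
  apply: nearW => m; apply: (@le_trans _ _ (\int[P]_x f m x)%E).
    by apply: ereal_inf_lbound; exists m => //=.
  by apply: gC; rewrite leq_addl.
- by apply/measurable_EFinP; apply: measurable_funX; exact: measurable_funB.
- rewrite /limn_einf; apply: measurableT_comp => //.
  by apply: measurable_fun_limn_esup => m; exact: measurableT_comp.
- by move=> x _; rewrite lee_fin sqr_ge0.
- move=> x _; rewrite limn_einf_lim; apply: lime_ge; first exact: is_cvg_einfs.
  by apply: nearW => m; apply: le_ereal_inf_tmp => _ [k _ <-].
- apply: filterS gh => x gx _.
  have c : (fun m => f m x) @ \oo --> ((h x - g n x) ^+ 2)%:E.
    apply: cvg_EFin; first exact: nearW.
    rewrite /f /=; apply: cvgM; apply: cvgB (cvg_cst _);
    by rewrite (cvg_shiftn n (g ^~ x)).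
  by rewrite is_cvg_limn_einfE; [rewrite (cvg_lim _ c) | exact: cvgP c].
Qed.

End L2.

(** * Functions with prescribed square summable coefficients *)

Section RieszFischer.
Context (R : realType) (d : nat).
Local Notation mu := (haar R d).
Implicit Types (c : d.-tuple int -> R[i]) (u v : torus R d -> R[i]).

(** Choose [F] with sum within [e] of the supremum; a disjoint [D] can then add at most [e]. *)
Lemma esum_tail c (e : R) : 0 < e ->
  (\esum_(k in [set: d.-tuple int]) (sqmod (c k))%:E < +oo)%E ->
  exists F : seq (d.-tuple int), forall D, uniq D -> {in D, forall k, k \notin F} ->
    \sum_(k <- D) sqmod (c k) <= e.
Proof.
move=> e0 fin; set S := (\esum_(_ in _) _)%E in fin.
have S0 : (0 <= S)%E by apply: esum_ge0 => k _; rewrite lee_fin sqmod_ge0.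
have Sfin : S \is a fin_num by rewrite ge0_fin_numE.
have [_ [X [finX _] <-] hX] := ub_ereal_sup_adherent e0 Sfin.
pose F : seq (d.-tuple int) := finmap.enum_fset (fset_set X).
exists F => D uD DX.
have {}hX : (S - e%:E < (\sum_(k <- F) sqmod (c k))%:E)%E.
  by move: hX; rewrite fsbig_finite // sumEFin.
have : ((\sum_(k <- F) sqmod (c k) + \sum_(k <- D) sqmod (c k))%:E <= S)%E.
  apply: esum_ge; exists [set` F ++ D]; first by split; [exact: finite_seq | ].
  rewrite -fsbig_seq; first by rewrite sumEFin big_cat.
  rewrite cat_uniq finmap.fset_uniq uD andbT /=.
  by apply/hasPn => k /DX.
rewrite -(fineK Sfin) in hX *.
by move: hX; rewrite -EFinB lte_fin lee_fin => h1 h2; lra.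
Qed.

(** Transfers L^2 closeness to the coefficients: [cis] has modulus 1, so each part of the integrand
    has its square bounded by [sqmod (u x)]. *)
Lemma fourier_coef_small u (e : R) k : cmeasurable u -> square_integrable u -> 0 < e ->
  (\int[mu]_x (sqmod (u x))%:E <= (e ^+ 2)%:E)%E ->
  `|complex.Re (fourier_coef u k)| <= 2 * e /\ `|complex.Im (fourier_coef u k)| <= 2 * e.
Proof.
move=> cu su e0 ue; have [mr mi] := cu.
have mp := measurable_funN (@measurable_wave_phase R d k).
have mc : measurable_fun setT (fun x : torus R d => cos (- wave_phase k x)).
  exact: measurableT_comp (continuous_measurable_fun (@continuous_cos R)) mp.
have ms : measurable_fun setT (fun x : torus R d => sin (- wave_phase k x)).
  exact: measurableT_comp (continuous_measurable_fun (@continuous_sin R)) mp.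
have mnc := measurable_funN mc.
have c1 x : `|cos (- wave_phase k x) : R| <= 1 by rewrite ler_norml cos_geN1 cos_le1.
have s1 x : `|sin (- wave_phase k x) : R| <= 1 by rewrite ler_norml sin_geN1 sin_le1.
have nc1 x : `|- cos (- wave_phase k x) : R| <= 1 by rewrite normrN.
have key (f : torus R d -> R) : mu.-integrable setT (EFin \o f) ->
    (forall x, f x ^+ 2 <= sqmod (u x)) -> `|\int[mu]_x f x| <= 2 * e.
  move=> fi fu; have mf : measurable_fun setT f.
    by apply/measurable_EFinP; exact: measurable_int fi.
  rewrite -lee_fin EFin_normr_Rintegral //.
  apply: (le_trans (le_abse_integral _ _ _)) => //; first exact: measurable_int fi.
  apply: ge0_integral_sqr_le_L1 => //; apply: le_trans ue.
  apply: ge0_le_integral => //.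
  - by move=> x _; rewrite lee_fin sqr_ge0.
  - by apply/measurable_EFinP; exact: measurable_funX.
  - by apply/measurable_EFinP; exact: measurable_sqmod.
  - by move=> x _; rewrite lee_fin.
have sq x : sqmod (u x) = sqmod (u x * cis (- wave_phase k x)).
  by rewrite sqmodM sqmod_cis mulr1.
split; apply: key => [|x].
- under eq_fun do rewrite /= ReM_cis.
  exact: integrable_modulated.
- by rewrite sq /sqmod lerDl sqr_ge0.
- under eq_fun do rewrite /= ImM_cis.
  exact: integrable_modulated.
- by rewrite sq /sqmod lerDr sqr_ge0.
Qed.

Lemma trig_sumB c (G H : seq (d.-tuple int)) x : uniq G -> uniq H -> {subset G <= H} ->
  trig_sum c H x - trig_sum c G x = trig_sum c [seq k <- H | k \notin G] x.
Proof.
move=> uG uH GH; rewrite /trig_sum (bigID (mem G)) /=.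
rewrite -[X in X + _ - _]big_filter (perm_big G) /=; last first.
  apply: uniq_perm => //; first exact: filter_uniq.
  by move=> k; rewrite mem_filter; apply/andP/idP => [[]//|kG]; split => //; exact: GH.
by rewrite addrAC subrr add0r big_filter.
Qed.

Lemma riesz_fischer c :
  (\esum_(k in [set: d.-tuple int]) (sqmod (c k))%:E < +oo)%E ->
  exists v, [/\ cmeasurable v, square_integrable v & forall k, fourier_coef v k = c k].
Proof.
move=> fin.
pose q (n : nat) : R := 2^-1 ^+ n.
have q0 n : 0 < q n by rewrite exprn_gt0 // invr_gt0.
have [F hF] := choice (fun n => esum_tail (exprn_gt0 2 (q0 n)) fin).
(* The union of [F 0] to [F n] makes the frequency sets nested; removing duplicates allows
   Parseval. *)
pose G n := undup (flatten [seq F i | i <- iota 0 n.+1]).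
have uG n : uniq (G n) by exact: undup_uniq.
have FG n : {subset F n <= G n}.
  move=> k kF; rewrite mem_undup; apply/flattenP; exists (F n) => //.
  by apply: map_f; rewrite mem_iota /= add0n ltnSn.
have GG n m : (n <= m)%N -> {subset G n <= G m}.
  move=> nm k; rewrite !mem_undup => /flattenP[s sF].
  have [i + ->] := mapP sF; rewrite mem_iota leq0n add0n => iN ki.
  apply/flattenP; exists (F i) => //.
  by apply: map_f; rewrite mem_iota /= add0n (leq_trans iN).
pose S n := trig_sum c (G n).
have Sdiff n m : (n <= m)%N ->
    (\int[mu]_x (sqmod (S m x - S n x))%:E <= (q n ^+ 2)%:E)%E.
  move=> nm; have E x := trig_sumB c x (uG n) (uG m) (GG n m nm).
  under eq_integral => x _ do rewrite /S E.
  rewrite parseval_trig_sum ?filter_uniq // lee_fin; apply: hF; first exact: filter_uniq.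
  by move=> k; rewrite mem_filter => /andP[+ _]; apply: contra; exact: FG.
have mS n := @cmeasurable_trig_sum R d c (G n).
(* Here [g] stands for the real or the imaginary part, each of which gets its own limit. *)
have dominated (g : R[i] -> R) : (forall z, g z ^+ 2 <= sqmod z) ->
    (forall z w, g (z - w) = g z - g w) ->
    (forall n, measurable_fun setT (fun x => g (S n x))) ->
    exists2 h : torus R d -> R, measurable_fun setT h & forall n,
      (\int[mu]_x ((h x - g (S n x)) ^+ 2)%:E <= ((2^-1 ^+ n) ^+ 2)%:E)%E.
  move=> gz gB mg; apply: (L2_limit (g := fun n x => g (S n x))) => // n m nm.
  apply: le_trans (Sdiff _ _ nm); apply: ge0_le_integral => //.
  - by move=> x _; rewrite lee_fin sqr_ge0.
  - by apply/measurable_EFinP; apply: measurable_funX; exact: measurable_funB.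
  - by apply/measurable_EFinP; exact: (measurable_sqmod (cmeasurableB (mS m) (mS n))).
  - by move=> x _; rewrite lee_fin -gB.
have [a ma ha] : exists2 h : torus R d -> R, measurable_fun setT h & forall n,
      (\int[mu]_x ((h x - complex.Re (S n x)) ^+ 2)%:E <= ((2^-1 ^+ n) ^+ 2)%:E)%E.
  apply: dominated; [by move=> z; rewrite /sqmod lerDl sqr_ge0 | exact: ReB |].
  by move=> n; have [] := mS n.
have [b mb hb] : exists2 h : torus R d -> R, measurable_fun setT h & forall n,
      (\int[mu]_x ((h x - complex.Im (S n x)) ^+ 2)%:E <= ((2^-1 ^+ n) ^+ 2)%:E)%E.
  apply: dominated; [by move=> z; rewrite /sqmod lerDr sqr_ge0 | exact: ImB |].
  by move=> n; have [] := mS n.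
pose v x := Complex (a x) (b x).
have cv : cmeasurable v by [].
(* The two parts give [2 * q n ^+ 2], rounded up to a perfect square. *)
have vS n : (\int[mu]_x (sqmod ((v - S n) x))%:E <= ((2 * q n) ^+ 2)%:E)%E.
  have sE x : (sqmod ((v - S n) x))%:E =
      (((a x - complex.Re (S n x)) ^+ 2)%:E + ((b x - complex.Im (S n x)) ^+ 2)%:E)%E.
    by rewrite -EFinD /sqmod ReB ImB.
  have [mr mi] := mS n.
  under eq_integral => x _ do rewrite sE.
  rewrite ge0_integralD //; last 4 first.
  - by move=> x _; rewrite lee_fin sqr_ge0.
  - by apply/measurable_EFinP; apply: measurable_funX; exact: measurable_funB.
  - by move=> x _; rewrite lee_fin sqr_ge0.
  - by apply/measurable_EFinP; apply: measurable_funX; exact: measurable_funB.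
  apply: (le_trans (leeD (ha n) (hb n))); rewrite -EFinD lee_fin -/(q n).
  by have := sqr_ge0 (q n); rewrite exprMn; lra.
have sS n := @square_integrable_trig_sum R d c (G n).
have svS n : square_integrable (v - S n).
  by apply: le_lt_trans (vS n) (ltry _).
have sv : square_integrable v.
  rewrite (_ : v = (v - S 0%N) - (0 - S 0%N)); last first.
    by rewrite sub0r opprK subrK.
  have c0 := @cmeasurable0 R d; have s0 := @square_integrable0 R d.
  apply: square_integrableB (svS 0%N) (square_integrableB c0 (mS 0%N) s0 (sS 0%N)).
    exact: (cmeasurableB cv (mS 0%N)).
  exact: (cmeasurableB c0 (mS 0%N)).
exists v; split => // k.
(* The constant 5 is 4 from [fourier_coef_small] at [2 * q n], plus 1 from the tail. *)
have close n : `|complex.Re (fourier_coef v k - c k)| <= 5 * q n /\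
               `|complex.Im (fourier_coef v k - c k)| <= 5 * q n.
  have e0 : 0 < 2 * q n by rewrite mulr_gt0.
  have [r i] := fourier_coef_small k (cmeasurableB cv (mS n)) (svS n) e0 (vS n).
  have vE := fourier_coefB cv (mS n) sv (sS n) k.
  have tail : sqmod (fourier_coef (S n) k - c k) <= q n ^+ 2.
    rewrite trig_sum_coef //; case: ifPn => kG.
      by rewrite subrr /sqmod /= expr0n addr0 sqr_ge0.
    (* A frequency outside [G n] lies outside [F n], so it is a tail by itself. *)
    have := hF n [:: k] erefl; rewrite big_seq1 sub0r /sqmod.
    have -> : complex.Re (- c k) ^+ 2 + complex.Im (- c k) ^+ 2 =
      complex.Re (c k) ^+ 2 + complex.Im (c k) ^+ 2.
      by case: (c k) => x y /=; rewrite !sqrrN.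
    apply => l; rewrite inE => /eqP ->; apply: contra kG; exact: FG.
  have tri : fourier_coef v k - c k =
      fourier_coef (v - S n) k + (fourier_coef (S n) k - c k).
    by rewrite vE addrA subrK.
  have le1 (x y : R) : x ^+ 2 + y ^+ 2 <= q n ^+ 2 -> `|x| <= q n /\ `|y| <= q n.
    move=> h; split; rewrite -(ler_pXn2r (n := 2)) ?nnegrE ?(ltW (q0 n)) //
      real_normK ?num_real //; apply: le_trans h.
      by rewrite lerDl sqr_ge0.
    by rewrite lerDr sqr_ge0.
  have [t1 t2] := le1 _ _ tail.
  rewrite tri ReD ImD; split; apply: (le_trans (ler_normD _ _)); lra.
have z0 (x : R) : (forall n, `|x| <= 5 * q n) -> x = 0.
  move=> h; apply/normr0_eq0/eqP; rewrite eq_le normr_ge0 andbT.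
  have c5 : (fun n => 5 * q n) @ \oo --> (5 * 0 : R).
    apply: cvgM; first exact: cvg_cst.
    apply: cvg_expr; rewrite ger0_norm ?invr_ge0 //.
    by rewrite invf_lt1 // ltr1n.
  rewrite mulr0 in c5.
  rewrite -(cvg_lim _ c5) //; apply: limr_ge; first exact: cvgP c5.
  exact: nearW.
apply/subr0_eq/eqP; rewrite eq_complex /=; apply/andP; split; apply/eqP; apply: z0 => n.
- by have [] := close n.
- by have [] := close n.
Qed.

End RieszFischer.

(** * Vanishing of all coefficients and vanishing almost everywhere *)

Section Torus.
Context (R : realType) (d : nat).
Local Notation mu := (haar R d).
Implicit Types (u v : torus R d -> R[i]).

Lemma fourier_coef_ae0 u k : cmeasurable u -> square_integrable u ->
  {ae mu, forall x, u x = 0} -> fourier_coef u k = 0.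
Proof.
move=> cu su u0.
have mp := measurable_funN (@measurable_wave_phase R d k).
have mc : measurable_fun setT (fun x : torus R d => cos (- wave_phase k x)).
  exact: measurableT_comp (continuous_measurable_fun (@continuous_cos R)) mp.
have ms : measurable_fun setT (fun x : torus R d => sin (- wave_phase k x)).
  exact: measurableT_comp (continuous_measurable_fun (@continuous_sin R)) mp.
have [mr mi] := cu.
have key (f : torus R d -> R) : measurable_fun setT f ->
    (forall x, u x = 0 -> f x = 0) -> \int[mu]_x f x = 0.
  move=> mf fu; rewrite /Rintegral (@ae_eq_integral _ _ _ mu _ (fun=> 0%E)) //.
  - by rewrite integral0.
  - exact/measurable_EFinP.
  - by move: u0; apply: filterS => x ux _; rewrite fu.
rewrite /fourier_coef /cintegral !key //.
- under eq_fun do rewrite /= ImM_cis.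
  by apply: measurable_funB; apply: measurable_funM => //; exact: measurable_funN.
- by move=> x ->; rewrite mul0r.
- under eq_fun do rewrite /= ReM_cis.
  by apply: measurable_funB; apply: measurable_funM.
- by move=> x ->; rewrite mul0r.
Qed.

(** A coefficient mixes the real and imaginary parts of [u]; the frequencies [k] and [-k] together
    separate them, and [orthogonal_ae0] applies to each part. *)
Lemma fourier_coef_inj0 u : cmeasurable u -> square_integrable u ->
  (forall k, fourier_coef u k = 0) -> {ae mu, forall x, u x = 0}.
Proof.
move=> cu su u0; have [mr mi] := cu.
have bound0 : forall x : torus R d, `|0 : R| <= 1 by move=> x; rewrite normr0.
have bound1 : forall x : torus R d, `|1 : R| <= 1 by move=> x; rewrite normr1.
have iRe : mu.-integrable setT (EFin \o (fun x => complex.Re (u x))).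
  have := @integrable_modulated R d u (cst 1) (cst 0) cu su
    (measurable_cst _) (measurable_cst _) bound1 bound0.
  by under eq_fun do rewrite mulr1 mulr0 subr0.
have iIm : mu.-integrable setT (EFin \o (fun x => complex.Im (u x))).
  have := @integrable_modulated R d u (cst 0) (cst (-1)) cu su
    (measurable_cst _) (measurable_cst _) bound0.
  under eq_fun do rewrite mulr0 mulrN1 sub0r opprK.
  by apply => x; rewrite normrN normr1.
clear bound0 bound1.
pose W f k t := \int[mu]_x (f x * cos (t + wave_phase k x)).
(* The sign [s] selects the frequency [k] or [-k]; phases 0 and [- (pi / 2)] give the cosine and
   sine integrals. *)
have coefE (k : d.-tuple int) (s : R) : s = 1 \/ s = -1 ->
   (W (fun x => complex.Re (u x)) k 0 + s * W (fun x => complex.Im (u x)) k (- (pi / 2)) = 0) /\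
   (W (fun x => complex.Im (u x)) k 0 - s * W (fun x => complex.Re (u x)) k (- (pi / 2)) = 0).
  move=> s1.
  pose l : d.-tuple int := [tuple (if s == 1 then tnth k i else - tnth k i) | i < d].
  have lE (x : torus R d) : wave_phase l x = s * wave_phase k x.
    rewrite /wave_phase mulr_sumr; apply: eq_bigr => i _; rewrite tnth_mktuple.
    case: s1 => ->; first by rewrite eqxx mul1r.
    rewrite (_ : (-1 == 1 :> R) = false); last by rewrite eqNr oner_eq0.
    by rewrite mulN1r mulrNz mulNr.
  have cE (x : torus R d) : cos (- wave_phase l x) = cos (0 + wave_phase k x).
    by rewrite add0r lE; case: s1 => ->; rewrite ?mul1r ?mulN1r ?opprK ?cosN.
  have sE (x : torus R d) : sin (- wave_phase l x) = - s * cos (- (pi / 2) + wave_phase k x).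
    rewrite [_ + wave_phase _ _]addrC cosBpihalf lE.
    by case: s1 => ->; rewrite ?mul1r ?mulN1r ?opprK ?mul1r ?sinN.
  have iW f t : mu.-integrable setT (EFin \o f) ->
    mu.-integrable setT (EFin \o (fun x => f x * cos (t + wave_phase k x))).
    exact: integrable_mul_cos.
  have := u0 l; rewrite /fourier_coef /cintegral => -[re im]; split.
  - rewrite -[RHS]re /W -RintegralZl //; last exact: iW.
    rewrite -RintegralD //; last 2 first.
    + exact: iW.
    + exact: (integrableZl measurableT s (iW _ _ iIm)).
    apply: eq_Rintegral => x _; rewrite ReM_cis cE sE; ring.
  - rewrite -[RHS]im /W -RintegralZl //; last exact: iW.
    rewrite -RintegralB //; last 2 first.
    + exact: iW.
    + exact: (integrableZl measurableT s (iW _ _ iRe)).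
    by apply: eq_Rintegral => x _; rewrite ImM_cis cE sE; ring.
have W0 k : [/\ W (fun x => complex.Re (u x)) k 0 = 0,
    W (fun x => complex.Re (u x)) k (- (pi / 2)) = 0,
    W (fun x => complex.Im (u x)) k 0 = 0 &
    W (fun x => complex.Im (u x)) k (- (pi / 2)) = 0].
  have [a b] := coefE k 1 (or_introl erefl).
  have [a' b'] := coefE k (-1) (or_intror erefl).
  by split; lra.
have orth f : mu.-integrable setT (EFin \o f) ->
    (forall k, W f k 0 = 0) -> (forall k, W f k (- (pi / 2)) = 0) ->
    {ae mu, forall x, f x = 0}.
  move=> fi f0 f1; apply: orthogonal_ae0; split => // k t.
  (* By the addition formula two phases determine all others. *)
  rewrite (_ : \int[mu]_x _ = cos t * W f k 0 + - sin t * W f k (- (pi / 2))).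
    by rewrite f0 f1 !mulr0 addr0.
  rewrite /W -!RintegralZl //; try exact: integrable_mul_cos.
  rewrite -RintegralD //; last 2 first.
  - exact: (integrableZl measurableT _ (integrable_mul_cos _ _ fi)).
  - exact: (integrableZl measurableT _ (integrable_mul_cos _ _ fi)).
  apply: eq_Rintegral => x _; rewrite add0r [- _ + _]addrC cosBpihalf cosD.
  by ring.
have hre := orth _ iRe (fun k => let: And4 a _ _ _ := W0 k in a)
  (fun k => let: And4 _ a _ _ := W0 k in a).
have him := orth _ iIm (fun k => let: And4 _ _ a _ := W0 k in a)
  (fun k => let: And4 _ _ _ a := W0 k in a).
move: hre him; apply: filterS2 => x; case: (u x) => a b /= -> ->.
by [].
Qed.

End Torus.

From mathcomp Require Import generic_quotient ring_quotient.
Local Open Scope quotient_scope.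

(** * Fourier coefficients on H^alpha *)

Section Sobolev.
Context (R : realType) (d : nat) (alpha : R).
Local Notation mu := (haar R d).
Implicit Types (f g : sobolev_fun (R := R) d alpha) (u v : sobolev (R := R) d alpha).

Lemma sobolev_funP f : in_sobolev alpha f.
Proof. by have := valP f; rewrite inE. Qed.

Lemma fourier_coef_sobolevB f g k :
  fourier_coef (f - g) k = fourier_coef f k - fourier_coef g k.
Proof.
by have [? ? _] := sobolev_funP f; have [? ? _] := sobolev_funP g; exact: fourier_coefB.
Qed.

Lemma fourier_coef_null f k : f \in @ae_null R d alpha -> fourier_coef f k = 0.
Proof.
by rewrite inE /= => f0; have [? ? _] := sobolev_funP f; exact: fourier_coef_ae0.
Qed.

(** The representative chosen by [fhat] differs from [f] by a null function, whose coefficients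
    vanish. *)
Lemma fhat_pi f : fhat (\pi_(sobolev (R := R) d alpha) f) =1 fourier_coef f.
Proof.
move=> k; apply/subr0_eq; rewrite /fhat -fourier_coef_sobolevB.
apply: fourier_coef_null.
by rewrite Quotient.idealrBE reprK.
Qed.

Lemma fhatB u v k : fhat (u - v) k = fhat u k - fhat v k.
Proof.
rewrite -[u]reprK -[v]reprK.
have -> : \pi_(sobolev d alpha) (repr u) - \pi_(sobolev d alpha) (repr v) =
    \pi_(sobolev d alpha) (repr u - repr v) by rewrite !piE.
by rewrite !fhat_pi fourier_coef_sobolevB.
Qed.

Lemma fhat0 k : fhat (0 : sobolev (R := R) d alpha) k = 0.
Proof. by rewrite -[X in fhat X](subrr (0 : sobolev d alpha)) fhatB subrr. Qed.

Lemma fhatD u v k : fhat (u + v) k = fhat u k + fhat v k.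
Proof. by rewrite -[v in LHS]opprK fhatB -[- v]sub0r fhatB fhat0 sub0r opprK. Qed.

(** The representative of [u - v] has zero coefficients, so it is null and its class is 0. *)
Lemma fhat_inj u v : fhat u =1 fhat v -> u = v.
Proof.
move=> uv; apply/subr0_eq.
have null : (repr (u - v) : sobolev_fun d alpha) \in @ae_null R d alpha.
  have [cw sw _] := sobolev_funP (repr (u - v)).
  rewrite inE /=; apply: fourier_coef_inj0 => // k.
  by have := fhatB u v k; rewrite uv subrr.
rewrite -[LHS]reprK (_ : 0 = \pi_(sobolev d alpha) 0); last by rewrite piE.
by apply/eqP; rewrite -Quotient.idealrBE subr0.
Qed.

(** A unimodular symbol preserves every [sqmod] of a coefficient. Since [alpha >= 0] the weights are
    at least 1, so the new coefficients are square summable and Riesz-Fischer applies; the Sobolev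
    norm is unchanged. *)
Lemma multiplier_exists (m : d.-tuple int -> R[i]) u : 0 <= alpha ->
  (forall k, sqmod (m k) = 1) -> exists v, forall k, fhat v k = m k * fhat u k.
Proof.
move=> a0 m1.
have [cu su hu] := sobolev_funP (repr u).
pose c k := m k * fhat u k.
have cE k : sqmod (c k) = sqmod (fourier_coef (repr u : sobolev_fun d alpha) k).
  by rewrite sqmodM m1 mul1r.
have [|v [cv sv vc]] := @riesz_fischer R d c.
  apply: le_lt_trans hu; apply: le_esum => k _; rewrite lee_fin cE.
  rewrite ler_peMl ?sqmod_ge0 //.
  rewrite -[leLHS](powRr0 (1 + sqfreq R k)); apply: ler_powR => //.
  by rewrite lerDl; apply: sumr_ge0 => i _; exact: sqr_ge0.
have vS : in_sobolev alpha v.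
  split => //; move: hu; rewrite /sobolev_sqnorm.
  by under eq_esum do rewrite -cE -vc.
exists (\pi_(sobolev d alpha) (SobolevFun (mem_set vS))) => k.
by rewrite fhat_pi /= vc.
Qed.

(** Existence rules out the default value of [xget]. *)
Lemma fhat_schrodinger (t : R) u k : 0 <= alpha ->
  fhat (schrodinger t u) k = cis (- (t * sqfreq R k)) * fhat u k.
Proof.
move=> a0; rewrite /schrodinger /fourier_multiplier.
have [v hv] := @multiplier_exists (fun k => cis (- (t * sqfreq R k))) u a0
  (fun k => sqmod_cis _).
by case: xgetP => [w _ ->|/(_ v)] //=.
Qed.

End Sobolev.

(** * Symmetry of the two-step scheme *)

Lemma cis_mulN (R : realType) (t : R) : cis (- t) * cis t = 1.
Proof. by rewrite -cisD addNr /cis cos0 sin0. Qed.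

Theorem proposition2p5 (R : realType) (d : nat) (hd : (1 <= d <= 3)%N)
    (alpha : R) (halpha : 0 <= alpha)
    (Phi Phit : R -> sobolev d alpha -> sobolev d alpha)
    (hPhi : forall (t : R) (v : sobolev d alpha),
      Phi t v = schrodinger t v + Phit t v) :
  symmetric_two_step (two_step_flow Phit).
Proof.
(* On each Fourier coefficient the propagators become scalars and symmetry is an algebraic
   identity. *)
move=> tau v w; apply: fhat_inj => k.
rewrite /two_step_flow opprK !(fhatB, fhatD, fhat_schrodinger) //.
rewrite (_ : - (2 * - tau * sqfreq R k) = 2 * tau * sqfreq R k); last by ring.
(* [e] is the symbol of the forward propagator and [e'] that of the backward one; [e' * e = 1]
   cancels the contributions of [Phit] in pairs. *)
set e := cis (- _); set e' := cis (2 * _ * _).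
have e1 : e' * e = 1 by rewrite mulrC cis_mulN.
rewrite mulrBr mulrDr !mulrA e1 !mul1r.
by ring.
Qed.
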